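(* Let $E$ be a uniformly complete vector lattice, let $Y$ be a convex bornological space, let $n,r\in\mathbb{N}\setminus\{1\}$, and let $P\colon E\to Y$ be a bounded $n$-homogeneous polynomial with associated symmetric $n$-linear map $\check{P}$. The following are equivalent. (i) $P$ is orthogonally additive. (ii) $P$ is positively orthogonally additive. (iii) $\check{P}$ is orthosymmetric. (iv) $\check{P}(f^{n-k}g^{k})=0$ for every $k\in\{1,\dots,n-1\}$ whenever $f,g\in E$ satisfy $f\perp g$. (v) $P\bigl(\mathfrak{S}_{n}(f_1,\dots,f_r)\bigr)=\sum_{k=1}^{r}P(f_k)$ holds for all $f_{1},\dots,f_{r}\in E^{+}$. (vi) $P\bigl(\mathfrak{G}_n(f_1,\dots,f_n)\bigr)=\check{P}(f_1,\dots,f_n)$ holds for all $f_{1},\dots,f_{n}\in E^{+}$. (vii) If $n$ is even, then $P(|z|)=\check{P}_{\mathbb{C}}\bigl(z^{\frac{n}{2}}(\bar{z})^{\frac{n}{2}}\bigr)$ holds for all $z\in E_{\mathbb{C}}$, while if $n$ is odd, then $P(|z|)=\check{P}_{\mathbb{C}}\bigl(z^{\frac{n-1}{2}}(\bar{z})^{\frac{n-1}{2}}|z|\bigr)$ holds for every $z\in E_{\mathbb{C}}$.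
   Context: $\mathbb{N}$ denotes the strictly positive integers. All vector spaces are real (apart from the complexifications below) and all vector lattices are Archimedean. $E^+$ denotes the positive cone of $E$, and $f,g\in E$ are disjoint (written $f\perp g$) if $|f|\wedge|g|=0$. Polynomials. A map $P\colon E\to Y$ is an $n$-homogeneous polynomial if there exists a (necessarily unique) symmetric $n$-linear map $\check{P}\colon E^n\to Y$ such that $P(f)=\check{P}(f,\dots,f)$ for all $f\in E$. It is orthogonally additive if $P(f+g)=P(f)+P(g)$ whenever $f,g\in E$ are disjoint, and positively orthogonally additive if $P(f+g)=P(f)+P(g)$ whenever $f,g\in E^+$ are disjoint. An $n$-linear map $T\colon E^n\to Y$ is orthosymmetric if $T(f_1,\dots,f_n)=0$ whenever $f_1,\dots,f_n\in E$ and there exist $i,j\in\{1,\dots,n\}$ with $f_i\perp f_j$. Convex bornological space is meant in the usual sense of bornology theory, and $P$ is bounded if it maps order bounded subsets of $E$ to bounded subsets of $Y$. Power notation. For $k_1,\dots,k_s\in\{0,\dots,n\}$ with $k_1+\dots+k_s=n$, $\check{P}(f_1^{k_1}f_2^{k_2}\cdots f_s^{k_s})$ denotes the value of $\check{P}$ at the $n$-tuple consisting of $k_1$ copies of $f_1$, $k_2$ copies of $f_2$, ..., $k_s$ copies of $f_s$. The same notation is used for $\check{P}_{\mathbb{C}}$. Means. For real numbers, $$\mathfrak{S}_n(x_1,\dots,x_r)=\sqrt[n]{\sum_{k=1}^{r}x_k^n},\qquad \mathfrak{G}_{n}(x_1,\dots,x_n)=\sqrt[n]{\prod_{k=1}^{n}|x_k|}.$$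 For elements of the uniformly complete vector lattice $E$, $\mathfrak{S}_n(f_1,\dots,f_r)$ and $\mathfrak{G}_n(f_1,\dots,f_n)$ are defined by the Archimedean vector lattice functional calculus: for a continuous positively homogeneous function $\omega\colon\mathbb{R}^s\to\mathbb{R}$ and $f_1,\dots,f_s\in E$, $\omega(f_1,\dots,f_s)$ is the unique element $g\in E$ such that $\phi(g)=\omega(\phi(f_1),\dots,\phi(f_s))$ for every real-valued vector lattice homomorphism $\phi$ on the vector sublattice of $E$ generated by $f_1,\dots,f_s,g$. Such a $g$ exists because $E$ is uniformly complete. Complexification. $E_{\mathbb{C}}=E\oplus iE$ is the vector space complexification of $E$. For $z=f+ig$ with $f,g\in E$, put $\bar{z}=f-ig$ and $|z|=\sup\{f\cos\theta+g\sin\theta : \theta\in[0,2\pi]\}\in E^+$ (this supremum exists because $E$ is uniformly complete). $Y_{\mathbb{C}}=Y\oplus iY$, and $\check{P}_{\mathbb{C}}\colon (E_{\mathbb{C}})^n\to Y_{\mathbb{C}}$ is the unique complex $n$-linear extension of $\check{P}$, that is, $$\check{P}_{\mathbb{C}}(f_1^{(0)}+if_1^{(1)},\dots,f_n^{(0)}+if_n^{(1)})=\sum_{\varepsilon\in\{0,1\}^n}i^{\varepsilon_1+\dots+\varepsilon_n}\check{P}(f_1^{(\varepsilon_1)},\dots,f_n^{(\varepsilon_n)}),$$ where $f_j^{(0)},f_j^{(1)}\in E$ and the superscripts $(0),(1)$ are indices, not powers.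
   Formalization: The convex bornological space Y is assumed separated (its only bounded vector subspace is {0}); without this the equivalence fails, e.g. for P(f) = (Df)² with D a derivation on C[0,1] modulo a non-maximal prime ideal and Y carrying the indiscrete bornology. *)

(* Defs.v *)
From HB Require Import structures.
From mathcomp Require Import all_boot all_order all_fingroup all_algebra.
From mathcomp Require Import all_classical all_reals all_analysis.
From mathcomp.real_closed Require Export complex.

Set Implicit Arguments.
Unset Strict Implicit.
Unset Printing Implicit Defensive.

Import Order.TTheory GRing.Theory Num.Theory.
Import numFieldNormedType.Exports.

Local Open Scope classical_set_scope.
Local Open Scope ring_scope.

HB.mixin Record POrderedLmodule_isVectorLattice (R : numDomainType) E
    & GRing.Lmodule R E & Order.POrder ring_display E := {
  vjoin : E -> E -> E ;
  vmeet : E -> E -> E ;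
  vjoinP : forall f g h : E, (vjoin f g <= h) = (f <= h) && (g <= h) ;
  vmeetP : forall f g h : E, (h <= vmeet f g) = (h <= f) && (h <= g) ;
  vl_leD2r : forall f g h : E, f <= g -> f + h <= g + h ;
  vl_scale_ge0 : forall (a : R) (f : E), 0 <= a -> 0 <= f -> 0 <= a *: f
}.

#[short(type="vlatticeType")]
HB.structure Definition VectorLattice (R : numDomainType) :=
  {E of GRing.Lmodule R E & Order.POrder ring_display E
      & POrderedLmodule_isVectorLattice R E}.

Section vector_lattices.
Context {R : realType} {E : vlatticeType R}.
Implicit Types (f g u : E) (L : set E).

Definition vabs f : E := vjoin f (- f).

Definition vdisjoint f g : Prop := vmeet (vabs f) (vabs g) = 0.

Definition order_bounded (A : set E) : Prop :=
  exists a b : E, forall f, A f -> a <= f <= b.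

Definition uniformly_cauchy u (s : nat -> E) : Prop :=
  forall e : R, 0 < e -> exists N, forall j k, (N <= j)%N -> (N <= k)%N ->
    vabs (s j - s k) <= e *: u.

Definition uniformly_converges u (s : nat -> E) f : Prop :=
  forall e : R, 0 < e -> exists N, forall k, (N <= k)%N ->
    vabs (s k - f) <= e *: u.

Definition vector_sublattice L : Prop :=
  [/\ L 0, forall (a : R) f g, L f -> L g -> L (a *: f + g),
      forall f g, L f -> L g -> L (vjoin f g) &
      forall f g, L f -> L g -> L (vmeet f g)].

(* phi restricts to a vector lattice homomorphism L -> R; its values outside L
   are irrelevant. *)
Definition vlattice_hom_on L (phi : E -> R) : Prop :=
  [/\ forall (a : R) f g, L f -> L g -> phi (a *: f + g) = a * phi f + phi g,
      forall f g, L f -> L g ->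
        phi (vjoin f g) = Num.max (phi f) (phi g) &
      forall f g, L f -> L g ->
        phi (vmeet f g) = Num.min (phi f) (phi g)].

Definition is_fcalc s (omega : ('I_s -> R) -> R) (f : 'I_s -> E) g : Prop :=
  forall phi : E -> R,
    vlattice_hom_on (smallest vector_sublattice (range f `|` [set g])) phi ->
    phi g = omega (phi \o f).

(* The default value 0 is not used when E is Archimedean and uniformly complete
   and omega is continuous and positively homogeneous: there is then exactly
   one g satisfying is_fcalc. *)
Definition fcalc s (omega : ('I_s -> R) -> R) (f : 'I_s -> E) : E :=
  xget 0 [set g | is_fcalc omega f g].

End vector_lattices.

Definition archimedean (R : realType) (E : vlatticeType R) : Prop :=
  forall f g : E, 0 <= f -> 0 <= g -> (forall k : nat, f *+ k <= g) -> f = 0.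

Definition uniformly_complete (R : realType) (E : vlatticeType R) : Prop :=
  forall (u : E) (s : nat -> E), 0 <= u -> uniformly_cauchy u s ->
    exists f, uniformly_converges u s f.

(* Convex bornological spaces are separated: {0} is the only bounded vector
   subspace. *)
HB.mixin Record Lmodule_isConvexBornological (R : numDomainType) Y
    & GRing.Lmodule R Y := {
  bornology : set (set Y) ;
  born_cover : \bigcup_(A in bornology) A = [set: Y] ;
  born_subset : forall A B : set Y, A `<=` B -> bornology B -> bornology A ;
  born_setU : forall A B : set Y,
    bornology A -> bornology B -> bornology (A `|` B) ;
  born_add : forall A B : set Y, bornology A -> bornology B ->
    bornology [set x + y | x in A & y in B] ;
  born_scale : forall (a : R) (A : set Y), bornology A ->
    bornology [set a *: x | x in A] ;
  born_circled : forall A : set Y, bornology A ->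
    bornology [set a *: x | a in [set a : R | `|a| <= 1] & x in A] ;
  born_convex : forall A : set Y, bornology A ->
    bornology (smallest (@convex_set R Y) A) ;
  born_separated : forall V : set Y,
    V 0 -> (forall (a : R) x y, V x -> V y -> V (a *: x + y)) ->
    bornology V -> V = [set 0]
}.

#[short(type="convexBornType")]
HB.structure Definition ConvexBornological (R : numDomainType) :=
  {Y of GRing.Lmodule R Y & Lmodule_isConvexBornological R Y}.

Definition bounded_map (R : realType) (E : vlatticeType R)
    (Y : convexBornType R) (P : E -> Y) : Prop :=
  forall A : set E, order_bounded A -> bornology (P @` A).

Section multilinear_maps.
Context {R : realType} {V W : lmodType R} {n : nat}.

Definition multilinear (T : ('I_n -> V) -> W) : Prop :=
  forall (f : 'I_n -> V) (i : 'I_n), linear (fun u : V => T (dfwith f i u)).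

Definition symmetric_map (T : ('I_n -> V) -> W) : Prop :=
  forall (s : 'S_n) (f : 'I_n -> V), T (f \o s) = T f.

(* P is an n-homogeneous polynomial, T its associated symmetric n-linear map *)
Definition homogeneous_polynomial (P : V -> W) (T : ('I_n -> V) -> W) : Prop :=
  [/\ multilinear T, symmetric_map T & forall f, P f = T (fun=> f)].

End multilinear_maps.

(* powers [:: (f1, k1); ...; (fs, ks)] is the n-tuple f1^k1 ... fs^ks, meant
   for k1 + ... + ks = n. *)
Definition powers (V : nmodType) n (s : seq (V * nat)) : 'I_n -> V :=
  fun i => nth 0 (flatten [seq nseq p.2 p.1 | p <- s]) i.

Section orthogonality.
Context {R : realType} {E : vlatticeType R} {Y : lmodType R}.

Definition orthogonally_additive (P : E -> Y) : Prop :=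
  forall f g : E, vdisjoint f g -> P (f + g) = P f + P g.

Definition positively_orthogonally_additive (P : E -> Y) : Prop :=
  forall f g : E, 0 <= f -> 0 <= g -> vdisjoint f g -> P (f + g) = P f + P g.

Definition orthosymmetric n (T : ('I_n -> E) -> Y) : Prop :=
  forall f : 'I_n -> E, (exists i j, vdisjoint (f i) (f j)) -> T f = 0.

End orthogonality.

Section means.
Context {R : realType}.

(* The real n-th root: the sign only matters for odd n. *)
Definition nroot (n : nat) (x : R) : R := Num.sg x * `|x| `^ n%:R^-1.

Definition Smean (n r : nat) (x : 'I_r -> R) : R :=
  nroot n (\sum_k x k ^+ n).

Definition Gmean (n : nat) (x : 'I_n -> R) : R :=
  nroot n (\prod_k `|x k|).

End means.

(* The pair (x, y) stands for x + i y. *)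
Definition complexification (R : realType) (V : lmodType R) : Type :=
  (V * V)%type.

Section complexification_lmodType.
Context {R : realType} {V : lmodType R}.

Let C := complexification V.

HB.instance Definition _ := GRing.Zmodule.copy C (V * V)%type.

Definition cplx_scale (a : R[i]) (z : C) : C :=
  (complex.Re a *: z.1 - complex.Im a *: z.2,
   complex.Re a *: z.2 + complex.Im a *: z.1).

Let cplx_scaleA a b z : cplx_scale a (cplx_scale b z) = cplx_scale (a * b) z.
Proof.
case: a b z => [a1 a2] [b1 b2] [x y]; rewrite /cplx_scale/=; congr pair.
  rewrite !scalerDr !scalerN !scalerDl !scaleNr !scalerA !opprD -!addrA.
  by congr (_ + _); rewrite addrA addrC.
rewrite !scalerDr !scalerN !scalerDl !scaleNr !scalerA -!addrA.
by congr (_ + _); rewrite addrA addrC.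
Qed.

Let cplx_scale1 : left_id 1 cplx_scale.
Proof.
by case=> x y; rewrite /cplx_scale/= !scale1r !scale0r subr0 addr0.
Qed.

Let cplx_scaleDr : right_distributive cplx_scale +%R.
Proof.
move=> a [x y] [x' y']; rewrite /cplx_scale/=; congr pair => /=.
  by rewrite !scalerDr opprD addrACA.
by rewrite !scalerDr addrACA.
Qed.

Let cplx_scaleDl z : {morph cplx_scale^~ z : a b / a + b}.
Proof.
case: z => x y [a1 a2] [b1 b2]; rewrite /cplx_scale/=; congr pair => /=.
  by rewrite !scalerDl opprD addrACA.
by rewrite !scalerDl addrACA.
Qed.

HB.instance Definition _ := GRing.Zmodule_isLmodule.Build R[i] C
  cplx_scaleA cplx_scale1 cplx_scaleDr cplx_scaleDl.

Definition cembed (x : V) : C := (x, 0).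

Definition cconj (z : C) : C := (z.1, - z.2).

End complexification_lmodType.

(* The supremum of f cos t + g sin t over t in [0, 2 pi], for z = f + i g; the
   default value 0 is not used when this supremum exists, in particular when E
   is Archimedean and uniformly complete. *)
Definition cmod (R : realType) (E : vlatticeType R) (z : complexification E) :
    E :=
  supremum 0 [set cos t *: z.1 + sin t *: z.2 | t in `[0, 2 * pi : R]].

Definition cextend (R : realType) (V W : lmodType R) n
    (T : ('I_n -> V) -> W) (z : 'I_n -> complexification V) :
    complexification W :=
  \sum_(e : {ffun 'I_n -> bool})
    (Complex 0 1 : R[i]) ^+ (\sum_j e j)%N *:
    cembed (T (fun j => if e j then (z j).2 else (z j).1)).

(* Main.v *)
Require Import Defs.
From mathcomp Require Import all_boot all_order all_fingroup all_algebra.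
From mathcomp Require Import all_classical all_reals all_analysis.
From mathcomp Require Import ring lra zify.

Set Implicit Arguments.
Unset Strict Implicit.
Unset Printing Implicit Defensive.

Import Order.TTheory GRing.Theory Num.Theory.
Local Open Scope classical_set_scope.
Local Open Scope ring_scope.

(** The theorem rests on a pointwise picture. Let [u >= 0] in [E]. The real lattice
    homomorphisms on the principal ideal of [u] that take the value one at [u]
    separate the points of this ideal ([ev_ge0P]; they are quotients by maximal
    ideals), so that the ideal becomes a space of bounded functions on a set.
    Uniform completeness makes it closed under uniform limits ([ev_limit]), hence
    under products and n-th roots ([ev_mul], [ev_root]). The means of the functional
    calculus and the modulus of a complex element are computed pointwise in this
    picture ([fcalc_ev], [cmod_ev]).

    From additivity on disjoint positive elements to orthosymmetry: by polarization,
    [T] vanishes on positive arguments that split into two mutually disjoint groups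
    ([mlin_split_eq0]). If merely two arguments are disjoint and in addition
    separated by a gap, then the remaining arguments can be cut inside the gap into
    parts which join one of two separated groups ([mlin_separated_eq0]). The gap is
    created by an arbitrarily small perturbation; since [T] is bounded and [Y] is
    separated, it does not affect the conclusion ([mlin_disjoint_eq0]).

    From orthosymmetry to the identities: a bounded bilinear map that vanishes on
    disjoint pairs depends only on the pointwise product of its arguments
    ([bilinear_local]). Therefore an orthosymmetric [T] is a linear function of the
    product of its [n] arguments ([mlin_factor]), and the three identities become
    identities between numbers: the n-th power of the power mean is the sum of the
    n-th powers, that of the geometric mean is the product, and the square of the
    modulus is the product of an element with its conjugate.

    Conversely, the power mean of disjoint positive elements is their sum, and the
    geometric mean of a tuple with two disjoint entries is zero. If the modulus
    identity is applied to [f + i s g] with [f] and [g] positive and disjoint, comparison of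
    coefficients with respect to [s] shows that the mixed terms of [P (f + g)] vanish ([modulus_mixed_eq0]). *)

(** * Vector lattices and their maximal ideals *)

Section vector_lattice_theory.
Context {R : realType} {E : vlatticeType R}.
Implicit Types (f g h u x y z : E) (a b c : R).

Lemma vleD2r f g h : (f + h <= g + h) = (f <= g).
Proof.
by apply/idP/idP => [/vl_leD2r-/(_ (- h))|/vl_leD2r//]; rewrite !addrK.
Qed.

Lemma vleD2l f g h : (h + f <= h + g) = (f <= g).
Proof. by rewrite ![h + _]addrC vleD2r. Qed.

Lemma vsub_ge0 f g : (0 <= g - f) = (f <= g).
Proof. by rewrite -(vleD2r 0 (g - f) f) add0r subrK. Qed.

Lemma vleN2 f g : (- f <= - g) = (g <= f).
Proof. by rewrite -(vsub_ge0 (- f) (- g)) opprK addrC vsub_ge0. Qed.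

Lemma vleNl f g : (- f <= g) = (- g <= f).
Proof. by rewrite -(vleN2 g (- f)) opprK. Qed.

Lemma vleNr f g : (f <= - g) = (g <= - f).
Proof. by rewrite -(vleN2 (- g) f) opprK. Qed.

Lemma vleD f g f' g' : f <= g -> f' <= g' -> f + f' <= g + g'.
Proof. by move=> h h'; apply: (@le_trans _ _ (g + f')); rewrite ?vleD2r ?vleD2l. Qed.

Lemma vaddr_ge0 f g : 0 <= f -> 0 <= g -> 0 <= f + g.
Proof. by move=> hf hg; rewrite -[0]addr0 vleD. Qed.

Lemma vleZ a f g : 0 <= a -> f <= g -> a *: f <= a *: g.
Proof.
by move=> a0; rewrite -vsub_ge0 => h; rewrite -vsub_ge0 -scalerBr vl_scale_ge0.
Qed.

Lemma vleZr a b f : 0 <= f -> a <= b -> a *: f <= b *: f.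
Proof. by move=> f0 ab; rewrite -vsub_ge0 -scalerBl vl_scale_ge0// subr_ge0. Qed.

Lemma vleZV a f g : 0 < a -> (a *: f <= g) = (f <= a^-1 *: g).
Proof.
move=> a0; apply/idP/idP => h.
  by rewrite -[f]scale1r -(mulVf (lt0r_neq0 a0)) -scalerA vleZ// invr_ge0 ltW.
by rewrite -[g]scale1r -(mulfV (lt0r_neq0 a0)) -scalerA vleZ// ltW.
Qed.

Lemma vjoinl f g : f <= vjoin f g.
Proof. by have := lexx (vjoin f g); rewrite vjoinP => /andP[]. Qed.

Lemma vjoinr f g : g <= vjoin f g.
Proof. by have := lexx (vjoin f g); rewrite vjoinP => /andP[]. Qed.

Lemma vmeetl f g : vmeet f g <= f.
Proof. by have := lexx (vmeet f g); rewrite vmeetP => /andP[]. Qed.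

Lemma vmeetr f g : vmeet f g <= g.
Proof. by have := lexx (vmeet f g); rewrite vmeetP => /andP[]. Qed.

Lemma vjoinC f g : vjoin f g = vjoin g f.
Proof. by apply/le_anti; rewrite !vjoinP !vjoinl !vjoinr. Qed.

Lemma vmeetN f g : vmeet f g = - vjoin (- f) (- g).
Proof.
apply/le_anti; rewrite vleNr vjoinP !vleN2 vmeetl vmeetr /=.
by rewrite vmeetP ![- vjoin _ _ <= _]vleNl vjoinl vjoinr.
Qed.

Lemma vjoinDr f g h : vjoin (f + h) (g + h) = vjoin f g + h.
Proof.
apply/le_anti; rewrite vjoinP !vleD2r vjoinl vjoinr /=.
by rewrite -(vleD2r _ _ (- h)) addrK vjoinP -!(vleD2r _ (_ - h) h) subrK vjoinl vjoinr.
Qed.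

Lemma vjoin_id f g : f <= g -> vjoin f g = g.
Proof. by move=> h; apply/le_anti; rewrite vjoinP h lexx vjoinr. Qed.

Lemma vabs_le f g : (vabs f <= g) = (f <= g) && (- f <= g).
Proof. exact: vjoinP. Qed.

Lemma vle_abs f : f <= vabs f.
Proof. exact: vjoinl. Qed.

Lemma vleN_abs f : - f <= vabs f.
Proof. exact: vjoinr. Qed.

Lemma vabs_ge0 f : 0 <= vabs f.
Proof.
suff : 0 <= 2^-1 *: (vabs f + vabs f).
  by rewrite -mulr2n -[vabs f *+ 2]scaler_nat scalerA mulVf// scale1r.
apply: vl_scale_ge0; first by rewrite invr_ge0.
by rewrite -[0](subrr f) vleD ?vle_abs ?vleN_abs.
Qed.

Lemma vabs_pos f : 0 <= f -> vabs f = f.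
Proof.
move=> f0; apply/le_anti; rewrite vabs_le lexx vle_abs /= andbT.
by apply: le_trans (f0); rewrite vleNl oppr0.
Qed.

Lemma vabsN f : vabs (- f) = vabs f.
Proof. by rewrite /vabs opprK vjoinC. Qed.

Lemma vabsD f g : vabs (f + g) <= vabs f + vabs g.
Proof. by rewrite vabs_le opprD !vleD ?vle_abs ?vleN_abs. Qed.

Lemma vabsZ_le a f : vabs (a *: f) <= `|a| *: vabs f.
Proof.
rewrite vabs_le -scaleNr; have [a0|a0] := ger0P a.
  by rewrite vleZ ?vle_abs//= scaleNr -scalerN vleZ// vleN_abs.
have na0 : 0 <= - a by rewrite oppr_ge0 ltW.
by rewrite andbC vleZ ?vle_abs//= -[a *: f]opprK -scaleNr -scalerN vleZ// vleN_abs.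
Qed.

Lemma vler_addr f g h : f <= g -> 0 <= h -> f <= g + h.
Proof. by move=> fg h0; rewrite -[f]addr0 vleD. Qed.

(** The join is a contraction for the absolute value, so that congruence modulo
    an ideal is compatible with joins. *)
Lemma vabs_vjoinB f g x y :
  vabs (vjoin f g - vjoin x y) <= vabs (f - x) + vabs (g - y).
Proof.
have H f' g' x' y' : vjoin f' g' - vjoin x' y' <= vabs (f' - x') + vabs (g' - y').
  rewrite -(vleD2r _ _ (vjoin x' y')) subrK vjoinP; apply/andP; split.
    by rewrite -[leLHS](subrK x') vleD ?vjoinl ?vler_addr ?vle_abs ?vabs_ge0.
  rewrite -[leLHS](subrK y') vleD ?vjoinr//.
  by rewrite [leRHS]addrC vler_addr ?vle_abs ?vabs_ge0.
rewrite vabs_le H opprB -(vabsN (f - x)) -(vabsN (g - y)) 2!opprB; exact: H.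
Qed.

Lemma vpos_abs f : vjoin f 0 <= vabs f.
Proof. by rewrite vjoinP vle_abs vabs_ge0. Qed.

Lemma vneg_abs f : vjoin (- f) 0 <= vabs f.
Proof. by rewrite -vabsN vpos_abs. Qed.

Lemma vpos_negB f : vjoin f 0 - vjoin (- f) 0 = f.
Proof.
by rewrite -[X in X - _](subrK f) -vjoinDr subrr add0r vjoinC addrC addKr.
Qed.

Lemma vpos_neg_disj f : vmeet (vjoin f 0) (vjoin (- f) 0) = 0.
Proof.
rewrite vmeetN; apply/eqP; rewrite oppr_eq0; apply/eqP.
rewrite -[X in vjoin (- X) _](subrK (vjoin (- f) 0)) vpos_negB opprD.
by rewrite -[X in vjoin _ X]add0r vjoinDr subrr.
Qed.

Definition uideal u : set E := [set f | exists c, vabs f <= c *: u].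

Definition videal (J : set E) : Prop :=
  [/\ J 0, forall a x y, J x -> J y -> J (a *: x + y) &
     forall x y, J y -> vabs x <= vabs y -> J x].

Section videal_theory.
Variables (J : set E) (Ji : videal J).

Lemma videalD x y : J x -> J y -> J (x + y).
Proof. by case: Ji => _ lin _ Jx Jy; rewrite -[x]scale1r; apply: lin. Qed.

Lemma videalZ a x : J x -> J (a *: x).
Proof. by case: Ji => J0 lin _ Jx; rewrite -[_ *: _]addr0; apply: lin. Qed.

Lemma videalN x : J x -> J (- x).
Proof. by rewrite -scaleN1r; apply: videalZ. Qed.

Lemma videal_le x y : J y -> 0 <= x -> x <= y -> J x.
Proof.
case: Ji => _ _ solid Jy x0 xy; apply: solid (Jy) _.
by rewrite !vabs_pos//; exact: le_trans xy.
Qed.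

Lemma videal_abs x : J (vabs x) -> J x.
Proof. by case: Ji => _ _ solid Jx; apply: solid Jx _; rewrite [leRHS]vabs_pos ?vabs_ge0. Qed.

End videal_theory.

(** Zorn's lemma. The union of a nonempty chain of ideals avoiding [u] is such an
    ideal. *)
Lemma maximal_videal u (J0 : set E) : videal J0 -> ~ J0 u ->
  exists J : set E, [/\ videal J, ~ J u, J0 `<=` J &
    forall J' : set E, videal J' -> ~ J' u -> J `<=` J' -> J' `<=` J].
Proof.
move=> J0i J0u.
pose P (J : set E) := J = set0 \/ [/\ videal J, ~ J u & J0 `<=` J].
have [|J [PJ maxJ]] := @Zorn_bigcup E P.
  move=> F FP Ftot.
  have [[X [FX X0]]|noX] := pselect (exists X, F X /\ X !=set0); last first.
    (* The chain may be empty, or consist of the empty set: this is why the family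
       [P] contains the empty set besides the ideals of interest. *)
    left; apply/seteqP; split => // x [X FX Xx]; apply: noX.
    by exists X; split => //; exists x.
  right.
  have good A : F A -> A !=set0 -> [/\ videal A, ~ A u & J0 `<=` A].
    by move=> /FP[->|//] [].
  have [[_ _ _] _ J0X] := good _ FX X0.
  split.
  - split.
    + by exists X => //; apply: J0X; case: J0i.
    + move=> a x y [A FA Ax] [B FB By].
      have [[_ linA _] _ _] := good _ FA (ex_intro _ _ Ax).
      have [[_ linB _] _ _] := good _ FB (ex_intro _ _ By).
      have [AB|BA] := Ftot _ _ FA FB.
        by exists B => //; apply: linB => //; exact: AB.
      by exists A => //; apply: linA => //; exact: BA.
    + move=> x y [A FA Ay] xy; exists A => //.
      have [[_ _ solid] _ _] := good _ FA (ex_intro _ _ Ay).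
      exact: solid Ay xy.
  - by move=> [A FA Au]; have [] := good _ FA (ex_intro _ _ Au).
  - by move=> x J0x; exists X => //; exact: J0X.
case: PJ => [J_eq0|[Ji Ju J0J]]; last first.
  exists J; split => // J' J'i J'u JJ' x J'x; apply: contrapT => Jx.
  apply: (maxJ J'); first by split => // J'J; apply/Jx/J'J.
  by right; split => //; exact: subset_trans JJ'.
exfalso; apply: (maxJ J0); last by right; split.
by rewrite J_eq0; split => // /(_ 0); apply; case: J0i.
Qed.

Section maximal_ideal.
Variables (u : E) (J : set E).
Hypotheses (u_ge0 : 0 <= u) (Ji : videal J) (Ju : ~ J u).
Hypothesis Jmax :
  forall J' : set E, videal J' -> ~ J' u -> J `<=` J' -> J' `<=` J.

(** The ideal generated by [J] and [x] is strictly larger than [J], hence it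
    contains [u]. *)
Lemma maximal_videal_dom x : 0 <= x -> ~ J x ->
  exists2 j, J j & exists2 c, 0 < c & u <= j + c *: x.
Proof.
move=> x0 Jx.
pose J' := [set z | exists2 j, J j & exists2 c, 0 < c & vabs z <= j + c *: x].
have J'i : videal J'.
  split.
  - exists 0; first by case: Ji.
    exists 1 => //; rewrite add0r scale1r vabs_pos//.
  - move=> a y z [j Jj [c c0 yj]] [k Jk [d d0 zk]].
    exists (`|a| *: j + k); first by case: Ji => _ lin _; apply: lin.
    exists (`|a| * c + d); first by rewrite ltr_wpDl// mulr_ge0// ltW.
    rewrite scalerDl addrACA -scalerA -scalerDr.
    apply: le_trans (vabsD _ _) _; apply: vleD => //.
    by apply: le_trans (vabsZ_le _ _) _; rewrite vleZ.
  - move=> y z [j Jj [c c0 zj]] yz; exists j => //; exists c => //.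
    exact: le_trans zj.
have [Ju'|J'u] := pselect (J' u).
  have [j Jj [c c0 uj]] := Ju'; exists j => //; exists c => //.
  by rewrite vabs_pos in uj.
exfalso; apply: Jx; apply: (Jmax J'i J'u).
  move=> y Jy; exists (vabs y).
    by case: Ji => _ _ solid; apply: solid Jy _; rewrite vabs_pos ?vabs_ge0.
  by exists 1 => //; rewrite scale1r vler_addr.
exists 0; first by case: Ji.
by exists 1 => //; rewrite add0r scale1r vabs_pos.
Qed.

(** If neither [x] nor [y] is in [J], then both dominate [u] modulo [J] up to a
    factor; so does their meet, which is zero, and [u] would be in [J]. *)
Lemma maximal_videal_prime x y : 0 <= x -> 0 <= y -> vmeet x y = 0 ->
  J x \/ J y.
Proof.
move=> x0 y0 xy; apply: contrapT => /not_orP[Jx Jy].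
have [j Jj [c c0 uj]] := maximal_videal_dom x0 Jx.
have [k Jk [d d0 uk]] := maximal_videal_dom y0 Jy.
apply: Ju; pose e := Num.max c d.
have e0 : 0 < e by rewrite lt_max c0.
have Je : J (vabs j + vabs k).
  by apply: videalD => //; case: Ji => _ _ solid;
    [apply: solid Jj _|apply: solid Jk _]; rewrite vabs_pos ?vabs_ge0.
apply: (videal_le Ji Je) => //.
suff : e^-1 *: (u - (vabs j + vabs k)) <= 0.
  by rewrite vleZV ?invr_gt0// scaler0 -(vleD2r _ _ (vabs j + vabs k)) subrK add0r.
rewrite -xy vmeetP !vleZV ?invr_gt0// invrK.
rewrite -![_ - _ <= _](vleD2r _ _ (vabs j + vabs k)) !subrK.
apply/andP; split.
  apply: le_trans uj _; rewrite addrC vleD//.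
    by apply: vleZr => //; rewrite le_max lexx.
  by rewrite vler_addr ?vle_abs ?vabs_ge0.
apply: le_trans uk _; rewrite addrC vleD//.
  by apply: vleZr => //; rewrite le_max lexx orbT.
by rewrite [leRHS]addrC vler_addr ?vle_abs ?vabs_ge0.
Qed.

(** The quotient by [J] is Archimedean with respect to the class of [u]. *)
Lemma maximal_videal_small w : 0 <= w ->
  (forall e, 0 < e -> exists2 j, J j & w <= j + e *: u) -> J w.
Proof.
move=> w0 small; apply: contrapT => Jw.
have [j Jj [c c0 uj]] := maximal_videal_dom w0 Jw.
have [k Jk wk] := small (2^-1 / c) ltac:(by rewrite divr_gt0).
have Jjk : J (j + c *: k) by apply: videalD => //; apply: videalZ.
apply: Ju; apply: (videal_le Ji (videalZ Ji 2 Jjk)) => //.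
rewrite -[2]invrK -vleZV ?invr_gt0//.
rewrite -(vleD2r _ _ (2^-1 *: u)) -scalerDl -mulr2n -[2^-1 *+ 2]mulr_natr mulVf// scale1r.
apply: le_trans uj _; rewrite -addrA vleD2l.
apply: le_trans (vleZ (ltW c0) wk) _.
by rewrite scalerDr scalerA mulrCA mulfV ?gt_eqF// mulr1.
Qed.

(** Modulo [J] every element of the principal ideal of [u] is a multiple of [u]:
    by primality each number [c] lies on one side of the class of [x], and the
    cut obtained in this way is the coordinate of [x]. *)
Lemma maximal_videal_coord x : uideal u x -> exists c, J (x - c *: u).
Proof.
move=> [C xC].
pose A := [set c | J (vjoin (x - c *: u) 0)].
have AC : A C.
  rewrite /A /= vjoin_id; first by case: Ji.
  by rewrite -(vleD2r _ _ (C *: u)) subrK add0r (le_trans _ xC)// vle_abs.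
have lbA : lbound A (- C).
  move=> c Ac; rewrite leNgt; apply/negP => cC.
  have d0 : 0 < - C - c by rewrite subr_gt0.
  apply: Ju; apply: (videal_le Ji (videalZ Ji (- C - c)^-1 Ac)) => //.
  rewrite -vleZV//; apply: le_trans _ (vjoinl _ _).
  rewrite scalerBl vleD2r scaleNr vleNl; apply: le_trans xC; exact: vleN_abs.
have infA : has_inf A by split; [exists C | exists (- C)].
exists (inf A); apply: (videal_abs Ji); apply: maximal_videal_small => [|e e0].
  exact: vabs_ge0.
have [a Aa ae] := inf_adherent e0 infA.
pose q := vjoin (- (x - (inf A - e) *: u)) 0.
have Jq : J q.
  have : ~ A (inf A - e).
    by move=> /(inf_lbound infA.2); rewrite lerBrDr gerDl leNgt e0.
  by have [] := maximal_videal_prime (vjoinr (x - (inf A - e) *: u) 0) (vjoinr _ _) (vpos_neg_disj _).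
exists (vjoin (x - a *: u) 0 + q); first exact: videalD.
rewrite vabs_le; apply/andP; split.
  apply: (@le_trans _ _ (x - a *: u + e *: u)).
    by rewrite -addrA vleD2l -!scaleNr -scalerDl vleZr//; lra.
  by rewrite vleD2r vler_addr ?vjoinl ?vjoinr.
rewrite -[leLHS](subrK (e *: u)) vleD2r; apply: (@le_trans _ _ q).
  by rewrite opprB addrAC -scalerBl -opprB; exact: vjoinl.
by rewrite [leRHS]addrC vler_addr ?vjoinr.
Qed.

End maximal_ideal.

(** * Real lattice homomorphisms on a principal ideal *)

Lemma vabs_vjoin f g : vabs (vjoin f g) <= vabs f + vabs g.
Proof.
by have := vabs_vjoinB f g 0 0; rewrite (vjoin_id (lexx 0)) !subr0.
Qed.

Lemma uideal_videal u : videal (uideal u).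
Proof.
split.
- by exists 0; rewrite scale0r vabs_pos.
- move=> a x y [c xc] [d yd]; exists (`|a| * c + d).
  rewrite scalerDl -scalerA; apply: le_trans (vabsD _ _) _; apply: vleD => //.
  by apply: le_trans (vabsZ_le _ _) _; rewrite vleZ.
- by move=> x y [c yc] xy; exists c; exact: le_trans yc.
Qed.

Lemma uideal0 u : uideal u 0.
Proof. by case: (uideal_videal u). Qed.

Lemma uideal_unit u : 0 <= u -> uideal u u.
Proof. by move=> u0; exists 1; rewrite scale1r vabs_pos. Qed.

Lemma uidealL u a x y : uideal u x -> uideal u y -> uideal u (a *: x + y).
Proof. by case: (uideal_videal u) => _ + _; apply. Qed.

Lemma uidealD u x y : uideal u x -> uideal u y -> uideal u (x + y).
Proof. exact: videalD (uideal_videal u) _ _. Qed.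

Lemma uidealZ u a x : uideal u x -> uideal u (a *: x).
Proof. exact: videalZ (uideal_videal u) _ _. Qed.

Lemma uidealN u x : uideal u x -> uideal u (- x).
Proof. exact: videalN (uideal_videal u) _. Qed.

Lemma uidealB u x y : uideal u x -> uideal u y -> uideal u (x - y).
Proof. by move=> ux uy; apply: uidealD => //; exact: uidealN. Qed.

Lemma uideal_solid u x y : uideal u y -> vabs x <= vabs y -> uideal u x.
Proof. by case: (uideal_videal u) => _ _; apply. Qed.

Lemma uideal_vabs u x : uideal u x -> uideal u (vabs x).
Proof. by move/uideal_solid; apply; rewrite vabs_pos ?vabs_ge0. Qed.

Lemma uideal_vjoin u x y : uideal u x -> uideal u y -> uideal u (vjoin x y).
Proof.
move=> ux uy; apply: (@uideal_solid _ _ (vabs x + vabs y)).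
  by apply: uidealD; exact: uideal_vabs.
by rewrite [leRHS]vabs_pos ?vaddr_ge0 ?vabs_ge0// vabs_vjoin.
Qed.

Lemma uideal_vmeet u x y : uideal u x -> uideal u y -> uideal u (vmeet x y).
Proof.
by move=> ux uy; rewrite vmeetN; apply/uidealN/uideal_vjoin; apply: uidealN.
Qed.

Lemma uideal_le u x c : 0 <= x -> x <= c *: u -> uideal u x.
Proof. by move=> x0 xc; exists c; rewrite vabs_pos. Qed.

Lemma uideal_sum u (I : Type) (r : seq I) (P : pred I) (F : I -> E) :
  (forall i, P i -> uideal u (F i)) -> uideal u (\sum_(i <- r | P i) F i).
Proof. by move=> uF; elim/big_ind : _ => //; [exact: uideal0|exact: uidealD]. Qed.

Lemma uideal_sublattice u : vector_sublattice (uideal u).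
Proof.
split; [exact: uideal0|exact: uidealL|exact: uideal_vjoin|exact: uideal_vmeet].
Qed.

(** The points of the Kakutani spectrum of the principal ideal of [u]; evaluation
    at these points represents the ideal by bounded real functions in which [u] is
    the constant one. *)
Definition uspec u : set (E -> R) :=
  [set phi | vlattice_hom_on (uideal u) phi /\ phi u = 1].

(** The quotient of the principal ideal of [u] by a maximal ideal is the real
    line; the quotient map is a point of the spectrum that vanishes on the given
    ideal. *)
Lemma uspec_videal u (J0 : set E) : 0 <= u -> videal J0 -> ~ J0 u ->
  exists2 phi, uspec u phi & forall x, J0 x -> uideal u x -> phi x = 0.
Proof.
move=> u0 J0i J0u.
have [J [Ji Ju J0J Jmax]] := maximal_videal J0i J0u.
pose phi x := xget 0 [set c | J (x - c *: u)].
have phi_uniq x c d : J (x - c *: u) -> J (x - d *: u) -> c = d.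
  move=> Jc Jd; apply: contrapT => /eqP; rewrite -subr_eq0 => cd; apply: Ju.
  rewrite -[u]scale1r -(mulVf cd) -scalerA; apply: videalZ => //.
  have -> : (c - d) *: u = (x - d *: u) - (x - c *: u).
    by rewrite opprB [RHS]addrC addrA subrK scalerBl.
  by apply: videalD => //; exact: videalN.
have phiJ x : uideal u x -> J (x - phi x *: u).
  by move=> /(maximal_videal_coord u0 Ji Ju Jmax) ex; rewrite /phi; apply: (@xgetPex _ 0 [set c | J (x - c *: u)]).
have phiE x c : uideal u x -> J (x - c *: u) -> phi x = c.
  by move=> ux; exact/phi_uniq/phiJ.
have phi_join x y : uideal u x -> uideal u y ->
    phi (vjoin x y) = Num.max (phi x) (phi y).
  move=> ux uy; apply: phiE; first exact: uideal_vjoin.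
  have -> : Num.max (phi x) (phi y) *: u = vjoin (phi x *: u) (phi y *: u).
    have [le|lt] := leP (phi x) (phi y).
      by rewrite vjoin_id// vleZr.
    by rewrite vjoinC vjoin_id// vleZr// ltW.
  case: (Ji) => _ _ solid.
  apply: (solid _ (vabs (x - phi x *: u) + vabs (y - phi y *: u))); last first.
    by rewrite [leRHS]vabs_pos ?vaddr_ge0 ?vabs_ge0// vabs_vjoinB.
  apply: videalD => //; [apply: solid (phiJ _ ux) _|apply: solid (phiJ _ uy) _].
    by rewrite vabs_pos ?vabs_ge0.
  by rewrite vabs_pos ?vabs_ge0.
have phi_lin a x y : uideal u x -> uideal u y ->
    phi (a *: x + y) = a * phi x + phi y.
  move=> ux uy; apply: phiE; first exact: uidealL.
  rewrite scalerDl opprD addrACA -scalerA -scalerBr.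
  by case: (Ji) => _ lin _; apply: lin; exact: phiJ.
have phiN x : uideal u x -> phi (- x) = - phi x.
  move=> ux; have := phi_lin (-1) x 0 ux (uideal0 u).
  have -> : phi 0 = 0.
    by apply: phiE; [exact: uideal0|rewrite scale0r subr0; case: Ji].
  by rewrite !addr0 scaleN1r mulN1r.
exists phi; last first.
  by move=> x J0x ux; apply: phiE => //; rewrite scale0r subr0; exact: J0J.
split; last by apply: phiE; [exact: uideal_unit|rewrite scale1r subrr; case: Ji].
split => // x y ux uy.
rewrite vmeetN phiN; last by apply: uideal_vjoin; exact: uidealN.
rewrite phi_join; [|exact: uidealN|exact: uidealN].
rewrite !phiN//.
by rewrite oppr_max !opprK.
Qed.

(** A homomorphism on a sublattice containing [u] is determined by its kernel and
    its value at [u]. A point of the spectrum that kills the ideal generated by the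
    kernel must therefore extend it. *)
Lemma uspec_extend u (L : set E) (psi : E -> R) : 0 <= u ->
  vector_sublattice L -> L u -> L `<=` uideal u ->
  vlattice_hom_on L psi -> psi u = 1 ->
  exists2 phi, uspec u phi & forall x, L x -> phi x = psi x.
Proof.
move=> u0 [L0 Llin Ljoin Lmeet] Lu LI [psilin psijoin psimeet] psiu.
have psi0 : psi 0 = 0.
  by have := psilin (-1) 0 0 L0 L0; rewrite scaler0 addr0 mulN1r addNr.
have LZ a x : L x -> L (a *: x) by move=> Lx; rewrite -[_ *: _]addr0; exact: Llin.
have psiZ a x : L x -> psi (a *: x) = a * psi x.
  by move=> Lx; rewrite -[_ *: _]addr0 psilin// psi0 addr0.
have LN x : L x -> L (- x) by rewrite -[- x]scaleN1r; exact: LZ.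
have Labs x : L x -> L (vabs x) by move=> Lx; apply: Ljoin => //; exact: LN.
have psiN x : L x -> psi (- x) = - psi x.
  by move=> Lx; rewrite -[- psi x]mulN1r -psiZ// scaleN1r.
have psiabs x : L x -> psi (vabs x) = Num.max (psi x) (- psi x).
  by move=> Lx; rewrite psijoin ?psiN//; exact: LN.
pose J0 := [set z | exists2 y, L y & psi y = 0 /\ vabs z <= y].
have J0i : videal J0.
  split.
  - by exists 0 => //; split => //; rewrite vabs_pos.
  - move=> a z t [zb Lzb [psizb zzb]] [tb Ltb [psitb ttb]].
    exists (`|a| *: zb + tb); first exact: Llin.
    split; first by rewrite psilin// psizb psitb mulr0 addr0.
    apply: le_trans (vabsD _ _) _; apply: vleD => //.
    by apply: le_trans (vabsZ_le _ _) _; rewrite vleZ.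
  - by move=> x y [z Lz [psiz yz]] xy; exists z => //; split => //; exact: le_trans yz.
(* An element of the kernel cannot dominate [u], at which [psi] is one. *)
have J0u : ~ J0 u.
  move=> [y Ly [psiy uy]]; rewrite vabs_pos// in uy.
  have := psijoin _ _ Lu Ly; rewrite vjoin_id// psiu psiy => /eqP.
  by rewrite max_l// eq_sym oner_eq0.
have [phi sphi phi0] := uspec_videal u0 J0i J0u.
exists phi => // x Lx; apply/eqP; rewrite -subr_eq0; apply/eqP.
have Lx' : L (- psi x *: u + x) by exact: Llin.
have -> : phi x - psi x = phi (- psi x *: u + x).
  case: sphi => -[philin _ _] phiu.
  by rewrite philin; [rewrite phiu mulr1 addrC|exact: LI|exact: LI].
apply: phi0; last exact: LI.
exists (vabs (- psi x *: u + x)); first exact: Labs.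
by split => //; rewrite psiabs// psilin// psiu mulr1 addNr oppr0 maxxx.
Qed.

End vector_lattice_theory.

Section evaluation.
Context {R : realType} {E : vlatticeType R}.
Variables (u : E) (phi : E -> R).
Hypothesis (phiP : uspec u phi).
Implicit Types (x y : E) (a : R).

Lemma evL a x y : uideal u x -> uideal u y ->
  phi (a *: x + y) = a * phi x + phi y.
Proof. by case: phiP => -[+ _ _] _; apply. Qed.

Lemma ev_unit : phi u = 1.
Proof. by case: phiP. Qed.

Lemma ev0 : phi 0 = 0.
Proof.
by have := evL (-1) (uideal0 u) (uideal0 u); rewrite scaler0 addr0 mulN1r addNr.
Qed.

Lemma evD x y : uideal u x -> uideal u y -> phi (x + y) = phi x + phi y.
Proof. by move=> ux uy; rewrite -[x]scale1r evL// scale1r mul1r. Qed.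

Lemma evZ a x : uideal u x -> phi (a *: x) = a * phi x.
Proof. by move=> ux; rewrite -[_ *: _]addr0 evL ?ev0 ?addr0//; exact: uideal0. Qed.

Lemma evN x : uideal u x -> phi (- x) = - phi x.
Proof. by move=> ux; rewrite -[- phi x]mulN1r -evZ// scaleN1r. Qed.

Lemma evB x y : uideal u x -> uideal u y -> phi (x - y) = phi x - phi y.
Proof. by move=> ux uy; rewrite evD ?evN//; exact: uidealN. Qed.

Lemma ev_join x y : uideal u x -> uideal u y ->
  phi (vjoin x y) = Num.max (phi x) (phi y).
Proof. by case: phiP => -[_ + _] _; apply. Qed.

Lemma ev_meet x y : uideal u x -> uideal u y ->
  phi (vmeet x y) = Num.min (phi x) (phi y).
Proof. by case: phiP => -[_ _ +] _; apply. Qed.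

Lemma ev_abs x : uideal u x -> phi (vabs x) = `|phi x|.
Proof.
by move=> ux; rewrite ev_join ?evN ?maxrN//; exact: uidealN.
Qed.

Lemma ev_le x y : uideal u x -> uideal u y -> x <= y -> phi x <= phi y.
Proof. by move=> ux uy xy; rewrite -(vjoin_id xy) ev_join// le_max lexx. Qed.

Lemma ev_ge0 x : uideal u x -> 0 <= x -> 0 <= phi x.
Proof. by move=> ux x0; rewrite -ev0; apply: ev_le => //; exact: uideal0. Qed.

Lemma ev_sum (I : Type) (r : seq I) (F : I -> E) :
  (forall i, uideal u (F i)) ->
  phi (\sum_(i <- r) F i) = \sum_(i <- r) phi (F i).
Proof.
move=> uF; elim: r => [|i r IH]; first by rewrite !big_nil ev0.
by rewrite !big_cons evD ?IH//; exact: uideal_sum.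
Qed.

End evaluation.

Section archimedean.
Context {R : realType} {E : vlatticeType R}.
Hypothesis (archE : archimedean E).
Variable (u : E).
Hypothesis (u_ge0 : 0 <= u).
Implicit Types (x y : E) (a c : R).

(** The Archimedean property in the form in which it is used: infinitesimals
    relative to [u] are not positive. *)
Lemma arch_small x : (forall e : R, 0 < e -> x <= e *: u) -> x <= 0.
Proof.
move=> small; suff : vjoin x 0 = 0 by move=> <-; exact: vjoinl.
apply: (archE (vjoinr _ _) u_ge0) => k.
case: k => [|k]; first by rewrite mulr0n.
rewrite -[leLHS]scaler_nat vleZV ?ltr0n// vjoinP vl_scale_ge0 ?invr_ge0// andbT.
by apply: small; rewrite invr_gt0.
Qed.

(** Points of the spectrum detect positivity. If [- x <= e *: u] fails for some
    [e], then the positive part [p] of [- x - e *: u] is nonzero, so the ideal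
    generated by the negative part [q], which is disjoint from [p], does not contain
    [u]. A point of the spectrum that vanishes at [q] sends [- x] to at least [e]. *)
Lemma ev_ge0P x : uideal u x ->
  (forall phi, uspec u phi -> 0 <= phi x) -> 0 <= x.
Proof.
move=> ux x0; rewrite -[x]opprK -vleNr oppr0.
apply: arch_small => e e0; set q := vjoin (- (- x - e *: u)) 0.
have uex : uideal u (- x - e *: u).
  by apply: uidealB; [exact: uidealN|apply/uidealZ/uideal_unit].
have uq : uideal u q by apply: uideal_vjoin; [exact: uidealN|exact: uideal0].
have [[c uc]|Jq] := pselect (uideal q u).
  have [d xd] := ux.
  set p := vjoin (- x - e *: u) 0.
  suff p0 : p <= 0.
    by have := le_trans (vjoinl _ _) p0; rewrite -(vleD2r _ _ (e *: u)) subrK add0r.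
  pose b := `|c| * `|d| + 1.
  have b0 : 0 < b by rewrite ltr_wpDl// mulr_ge0.
  have q0 : 0 <= q := vjoinr _ _.
  have pq : p <= b *: q.
    apply: (@le_trans _ _ (vabs x)).
      rewrite vjoinP vabs_ge0 andbT; apply: le_trans (vleN_abs x).
      by rewrite -[leRHS]subr0 vleD2l vleN2 vl_scale_ge0// ltW.
    apply: le_trans xd _; apply: (@le_trans _ _ (`|d| *: u)).
      by rewrite vleZr// ler_norm.
    rewrite vabs_pos// in uc.
    apply: (@le_trans _ _ (`|d| *: (`|c| *: q))).
      by rewrite vleZ//; apply: le_trans uc _; rewrite vleZr// ler_norm.
    by rewrite scalerA vleZr// mulrC lerDl.
  (* Here [q] dominates [u], hence [p], up to a factor; being disjoint from [q], the
     element [p] is then zero. *)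
  have bp : b^-1 *: p <= 0.
    rewrite -(vpos_neg_disj (- x - e *: u)) vmeetP vleZV ?invr_gt0// invrK.
    rewrite vleZV ?invr_gt0// invrK pq andbT -[leLHS]scale1r vleZr//.
      exact: vjoinr.
    by rewrite lerDr mulr_ge0.
  by move: bp; rewrite vleZV ?invr_gt0// scaler0.
have [phi phiP phi0] := uspec_videal u_ge0 (uideal_videal q) Jq.
have := phi0 q (uideal_unit (vjoinr _ _)) uq.
rewrite (ev_join phiP) ?(ev0 phiP) ?(evN phiP)//; last 2 first.
- exact: uidealN.
- exact: uideal0.
have uNx := uidealN ux; have ueu : uideal u (e *: u) by exact/uidealZ/uideal_unit.
rewrite (evB phiP)// (evN phiP)// (evZ phiP) ?(ev_unit phiP)//; last exact: uideal_unit.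
have := x0 _ phiP; move: e0; set a := phi x => e0 a0 /eqP.
by rewrite eq_le ge_max => /andP[/andP[+ _] _]; rewrite mulr1 opprB opprK leNgt ltr_wpDr.
Qed.

Lemma ev_leP x y : uideal u x -> uideal u y ->
  (forall phi, uspec u phi -> phi x <= phi y) -> x <= y.
Proof.
move=> ux uy xy; rewrite -vsub_ge0; apply: ev_ge0P => [|phi phiP].
  exact: uidealB.
by rewrite (evB phiP)// subr_ge0 xy.
Qed.

Lemma ev_inj x y : uideal u x -> uideal u y ->
  (forall phi, uspec u phi -> phi x = phi y) -> x = y.
Proof.
by move=> ux uy xy; apply/le_anti/andP; split; apply: ev_leP => // phi /xy ->.
Qed.

Lemma ev_disjoint x y : uideal u x -> uideal u y ->
  (forall phi, uspec u phi -> phi x = 0 \/ phi y = 0) -> vdisjoint x y.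
Proof.
move=> ux uy xy; apply: ev_inj => [||phi phiP].
- by apply: uideal_vmeet; exact: uideal_vabs.
- exact: uideal0.
rewrite (ev_meet phiP) ?(ev_abs phiP) ?(ev0 phiP)//; [|exact: uideal_vabs..].
by have [->|->] := xy _ phiP; rewrite normr0; [rewrite min_l|rewrite min_r].
Qed.

Lemma disjoint_ev x y phi : uideal u x -> uideal u y -> uspec u phi ->
  vdisjoint x y -> phi x = 0 \/ phi y = 0.
Proof.
move=> ux uy phiP xy; have := ev_meet phiP (uideal_vabs ux) (uideal_vabs uy).
rewrite xy (ev0 phiP) !(ev_abs phiP)//.
by have [_ /esym/eqP|_ /esym/eqP] := leP; rewrite normr_eq0 => /eqP; tauto.
Qed.

End archimedean.

(** * Continuous functions of elements of a principal ideal *)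

Section hat.
Context {R : realType}.
Implicit Types (s t : R).

Definition hat t : R := Num.max 0 (1 - `|t|).

Lemma hat_ge0 t : 0 <= hat t.
Proof. by rewrite /hat le_max lexx. Qed.

Lemma hat_eq0 t : 1 <= `|t| -> hat t = 0.
Proof. by move=> t1; rewrite /hat max_l// subr_le0. Qed.

(** The hats at the integers form a partition of unity which reproduces linear
    functions. The induction on [N] also needs the values beyond the last node,
    where only the last hat can be nonzero. *)
Lemma sum_hat_tail (N : nat) s : 0 <= s ->
  (s <= N%:R -> \sum_(i < N.+1) hat (s - i%:R) = 1 /\
                \sum_(i < N.+1) i%:R * hat (s - i%:R) = s) /\
  (N%:R <= s -> \sum_(i < N.+1) hat (s - i%:R) = hat (s - N%:R) /\
                \sum_(i < N.+1) i%:R * hat (s - i%:R) = N%:R * hat (s - N%:R)).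
Proof.
move=> s0; elim: N => [|N [IH1 IH2]].
  rewrite !big_ord_recr !big_ord0 /= !add0r !mul0r; split => // s_le0.
  have -> : s = 0 by apply/le_anti; rewrite s_le0 s0.
  by rewrite subr0 /hat normr0 subr0 max_r.
rewrite !(big_ord_recr N.+1) /=; split => sN; last first.
  have Ns : N%:R <= s by apply: le_trans sN; rewrite ler_nat.
  have [-> ->] := IH2 Ns; rewrite [hat (s - N%:R)]hat_eq0 ?mulr0 ?add0r//.
  by rewrite -natr1 in sN; rewrite ger0_norm; lra.
have [Ns|Ns] := leP s N%:R.
  have [-> ->] := IH1 Ns; rewrite hat_eq0 ?mulr0 ?addr0//.
  by rewrite -natr1 ler0_norm; lra.
have [-> ->] := IH2 (ltW Ns); rewrite -natr1 in sN *.
rewrite /hat ger0_norm ?ler0_norm; [|lra..].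
by rewrite !max_r; [split|..]; lra.
Qed.

Lemma sum_hat (N : nat) s : 0 <= s <= N%:R -> \sum_(i < N.+1) hat (s - i%:R) = 1.
Proof. by move=> /andP[s0 sN]; have [/(_ sN)[]] := sum_hat_tail N s0. Qed.

Lemma sum_nat_hat (N : nat) s : 0 <= s <= N%:R ->
  \sum_(i < N.+1) i%:R * hat (s - i%:R) = s.
Proof. by move=> /andP[s0 sN]; have [/(_ sN)[]] := sum_hat_tail N s0. Qed.

End hat.

Section calculus.
Context {R : realType} {E : vlatticeType R}.
Hypothesis (archE : archimedean E) (compE : uniformly_complete E).
Variable (u : E).
Hypothesis (u_ge0 : 0 <= u).
Implicit Types (x y z : E) (a c : R).

Lemma ev_normP x c : uideal u x ->
  (vabs x <= c *: u) <-> (forall phi, uspec u phi -> `|phi x| <= c).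
Proof.
move=> ux; have uu := uideal_unit u_ge0; split => [xc phi phiP|xc].
  have := ev_le phiP (uideal_vabs ux) (uidealZ c uu) xc.
  by rewrite (ev_abs phiP)// (evZ phiP)// (ev_unit phiP) mulr1.
apply: (ev_leP archE u_ge0) => //; [exact: uideal_vabs|exact: uidealZ|move=> phi phiP].
by rewrite (ev_abs phiP)// (evZ phiP)// (ev_unit phiP) mulr1 xc.
Qed.

(** Uniform completeness: the functions on the spectrum that come from the ideal
    form a uniformly closed set. *)
Lemma ev_limit (F : (E -> R) -> R) :
  (forall e : R, 0 < e -> exists2 x, uideal u x &
     forall phi, uspec u phi -> `|phi x - F phi| <= e) ->
  exists2 x, uideal u x & forall phi, uspec u phi -> phi x = F phi.
Proof.
move=> approx.
have /choice[s sP] : forall k : nat, exists x, uideal u x /\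
    forall phi, uspec u phi -> `|phi x - F phi| <= k.+1%:R^-1.
  by move=> k; have [|x ux xF] := approx k.+1%:R^-1; [rewrite invr_gt0|exists x].
have us k : uideal u (s k) by have [] := sP k.
have sF k phi : uspec u phi -> `|phi (s k) - F phi| <= k.+1%:R^-1.
  by have [_] := sP k; apply.
have small (e : R) : 0 < e -> exists N : nat, forall k, (N <= k)%N -> k.+1%:R^-1 <= e.
  move=> e0; have [N Ne] := ltr_add_invr e0.
  rewrite add0r in Ne; exists N => k Nk; apply: le_trans (ltW Ne).
  by rewrite lef_pV2 ?posrE ?ltr0n// ler_nat.
have cauchy : uniformly_cauchy u s.
  move=> e e0; have [|N HN] := small (e / 2); first by rewrite divr_gt0.
  exists N => j k Nj Nk; apply/ev_normP; first exact: uidealB.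
  move=> phi phiP; rewrite (evB phiP)//.
  have -> : phi (s j) - phi (s k) = (phi (s j) - F phi) - (phi (s k) - F phi) by ring.
  apply: le_trans (ler_normB _ _) _; rewrite [leRHS]splitr.
  by apply: lerD; [apply: le_trans (HN _ Nj)|apply: le_trans (HN _ Nk)]; exact: sF.
have [x sx] := compE u_ge0 cauchy.
have ux : uideal u x.
  have [N /(_ N (leqnn _)) xN] := sx 1 ltr01.
  have -> : x = s N - (s N - x) by rewrite opprB addrC subrK.
  by apply: uidealB => //; exists 1.
exists x => // phi phiP; apply/eqP; rewrite -subr_eq0 -normr_le0.
apply/ler_addgt0Pr => e e0; rewrite add0r.
have e2 : 0 < e / 2 by rewrite divr_gt0.
have [N sN] := sx _ e2; have [M HM] := small _ e2.
pose k := maxn N M.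
have -> : phi x - F phi = (phi (s k) - F phi) - (phi (s k) - phi x) by ring.
apply: le_trans (ler_normB _ _) _; rewrite [leRHS]splitr; apply: lerD.
  by apply: le_trans (HM k _); [exact: sF|rewrite leq_maxr].
rewrite -(evB phiP)//.
have := sN k; rewrite leq_maxl => /(_ isT) /ev_normP; apply => //.
exact: uidealB.
Qed.

Definition vhat x := vjoin 0 (u - vabs x).

Lemma uideal_vhat x : uideal u x -> uideal u (vhat x).
Proof.
move=> ux; apply: uideal_vjoin; first exact: uideal0.
by apply: uidealB; [exact: uideal_unit|exact: uideal_vabs].
Qed.

Lemma ev_vhat x phi : uideal u x -> uspec u phi -> phi (vhat x) = hat (phi x).
Proof.
move=> ux phiP; have uu := uideal_unit u_ge0; have uax := uideal_vabs ux.
rewrite (ev_join phiP) ?(ev0 phiP) ?(evB phiP)//; [|exact: uideal0|exact: uidealB].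
by rewrite (ev_unit phiP) (ev_abs phiP).
Qed.

Definition vlayer N x i := vhat (N%:R *: x - i%:R *: u).

Lemma uideal_vlayer N x i : uideal u x -> uideal u (vlayer N x i).
Proof.
move=> ux; apply/uideal_vhat/uidealB; first exact: uidealZ.
exact/uidealZ/uideal_unit.
Qed.

Lemma ev_vlayer N x i phi : uideal u x -> uspec u phi ->
  phi (vlayer N x i) = hat (N%:R * phi x - i%:R).
Proof.
move=> ux phiP; have uu := uideal_unit u_ge0.
rewrite ev_vhat//; last by apply: uidealB; exact: uidealZ.
by rewrite (evB phiP) ?(evZ phiP) ?(ev_unit phiP) ?mulr1//; exact: uidealZ.
Qed.

Lemma uideal_box x : 0 <= x -> x <= u -> uideal u x.
Proof. by move=> x0 xu; apply: (@uideal_le _ _ _ _ 1) => //; rewrite scale1r. Qed.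

Lemma ev_box x phi : 0 <= x -> x <= u -> uspec u phi -> 0 <= phi x <= 1.
Proof.
move=> x0 xu phiP; have ux := uideal_box x0 xu.
rewrite (ev_ge0 phiP)//= -(ev_unit phiP); apply: (ev_le phiP) => //.
exact: uideal_unit.
Qed.

(** Piecewise linear interpolation of [omega] at the nodes [i / N] is a combination
    of hats, so it can be carried out inside the ideal; the interpolants converge
    uniformly. *)
Lemma ev_calculus (omega : R -> R) x : 0 <= x -> x <= u ->
  (forall e : R, 0 < e -> exists2 d : R, 0 < d &
     forall s t, 0 <= s <= 1 -> 0 <= t <= 1 -> `|s - t| <= d ->
       `|omega s - omega t| <= e) ->
  exists2 y, uideal u y & forall phi, uspec u phi -> phi y = omega (phi x).
Proof.
move=> x0 xu unif; have ux := uideal_box x0 xu.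
apply: (@ev_limit (fun phi => omega (phi x))) => e e0.
have [d d0 dP] := unif _ e0.
have [n nd] := ltr_add_invr d0; rewrite add0r in nd.
set N := n.+1 in nd.
have N0 : 0 < N%:R :> R by rewrite ltr0n.
exists (\sum_(i < N.+1) omega (i%:R / N%:R) *: vlayer N x i).
  by apply: uideal_sum => i _; apply/uidealZ/uideal_vlayer.
move=> phi phiP; rewrite (ev_sum phiP); last first.
  by move=> i; apply/uidealZ/uideal_vlayer.
have phix := ev_box x0 xu phiP; set t := phi x in phix *.
have tN : 0 <= N%:R * t <= N%:R.
  by case/andP: phix => t0 t1; rewrite mulr_ge0//= ger_pMr.
have sumE a : a = \sum_(i < N.+1) a * hat (N%:R * t - i%:R).
  by rewrite -mulr_sumr sum_hat// mulr1.
rewrite [omega t]sumE -sumrB.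
apply: le_trans (ler_norm_sum _ _ _) _.
rewrite [leRHS]sumE.
apply: ler_sum => i _; rewrite (evZ phiP); last exact: uideal_vlayer.
rewrite ev_vlayer// -/t -mulrBl normrM (ger0_norm (hat_ge0 _)).
have [far|near] := leP 1 `|N%:R * t - i%:R|; first by rewrite hat_eq0 ?mulr0.
apply: ler_wpM2r; first exact: hat_ge0.
apply: dP => //.
  by rewrite divr_ge0//= ler_pdivrMr// mul1r ler_nat -ltnS.
have -> : i%:R / N%:R - t = - ((N%:R * t - i%:R) / N%:R).
  by field; rewrite gt_eqF.
rewrite normrN normrM (gtr0_norm (x := N%:R^-1)) ?invr_gt0//.
by apply: le_trans (ltW nd); rewrite ler_piMl// ?invr_ge0 ltW.
Qed.

(** Together with polarization this makes the ideal closed under pointwise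
    products. *)
Lemma ev_square x : 0 <= x -> x <= u ->
  exists2 y, uideal u y & forall phi, uspec u phi -> phi y = phi x ^+ 2.
Proof.
move=> x0 xu; apply: (ev_calculus (omega := fun t => t ^+ 2)) => // e e0.
exists (e / 2) => [|s t /andP[s0 s1] /andP[t0 t1] st]; first by rewrite divr_gt0.
rewrite subr_sqr normrM -[leRHS](divfK (x := 2))//.
by apply: ler_pM => //; rewrite ger0_norm ?addr_ge0//; lra.
Qed.

Lemma uideal_bound x : uideal u x -> exists2 c, 0 < c & vabs x <= c *: u.
Proof.
move=> [d xd]; exists (`|d| + 1); first by rewrite ltr_wpDl.
apply: le_trans xd _; apply: vleZr => //.
by apply: le_trans (ler_norm d) _; rewrite lerDl.
Qed.

(** Reduction to elements between [0] and [u], the domain of [ev_calculus]. *)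
Lemma uideal_rescale x : uideal u x -> exists2 c, 0 < c &
  let y := (2 * c)^-1 *: (x + c *: u) in 0 <= y /\ y <= u.
Proof.
move=> /uideal_bound[c c0 xc]; exists c => //=; split.
  apply: vl_scale_ge0; first by rewrite invr_ge0 mulr_ge0// ltW.
  by rewrite -[x]opprK addrC vsub_ge0; apply: le_trans (vleN_abs x) _.
rewrite vleZV ?invr_gt0 ?mulr_gt0// invrK mulr_natl mulr2n scalerDl vleD2r.
by apply: le_trans (vle_abs x) _.
Qed.

Lemma ev_mul x y : uideal u x -> uideal u y ->
  exists2 z, uideal u z & forall phi, uspec u phi -> phi z = phi x * phi y.
Proof.
move=> ux uy; have uu := uideal_unit u_ge0.
have [c c0 /=] := uideal_rescale ux; set x' := _ *: _ => -[x'0 x'u].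
have [d d0 /=] := uideal_rescale uy; set y' := _ *: _ => -[y'0 y'u].
have [p up pE] := ev_square x'0 x'u; have [q uq qE] := ev_square y'0 y'u.
have [||r ur rE] := @ev_square (2^-1 *: (x' + y')).
- by apply: vl_scale_ge0; [rewrite invr_ge0|exact: vaddr_ge0].
- rewrite vleZV ?invr_gt0// invrK (scaler_nat 2 u) mulr2n; exact: vleD.
pose z' := 2 *: r - 2^-1 *: p - 2^-1 *: q.
exists ((4 * c * d) *: z' - d *: x - c *: y - (c * d) *: u).
  by rewrite /z'; do ?[apply: uidealB|apply: uidealZ].
move=> phi phiP.
have ux' := uideal_box x'0 x'u; have uy' := uideal_box y'0 y'u.
have evx : phi x' = (2 * c)^-1 * (phi x + c).
  by rewrite (evZ phiP) ?(evD phiP) ?(evZ phiP) ?(ev_unit phiP) ?mulr1//;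
    do ?[apply: uidealD|apply: uidealZ].
have evy : phi y' = (2 * d)^-1 * (phi y + d).
  by rewrite (evZ phiP) ?(evD phiP) ?(evZ phiP) ?(ev_unit phiP) ?mulr1//;
    do ?[apply: uidealD|apply: uidealZ].
have uxy : uideal u (x' + y') by exact: uidealD.
rewrite /z' !(evB phiP, evZ phiP);
  do ?[apply: uidealB|apply: uidealZ] => //.
rewrite pE// qE// rE// (evZ phiP)// (evD phiP)// evx evy (ev_unit phiP).
by field; rewrite !gt_eqF.
Qed.

Lemma ev_prod (I : Type) (r : seq I) (F : I -> E) :
  (forall i, uideal u (F i)) ->
  exists2 z, uideal u z &
    forall phi, uspec u phi -> phi z = \prod_(i <- r) phi (F i).
Proof.
move=> uF; elim: r => [|i r [z uz zE]].
  by exists u => [|phi phiP]; [exact: uideal_unit|rewrite big_nil (ev_unit phiP)].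
have [w uw wE] := ev_mul (uF i) uz.
by exists w => // phi phiP; rewrite big_cons wE// zE.
Qed.

(** The n-th root is uniformly continuous because the n-th power is superadditive
    on nonnegative numbers. *)
Lemma expr_dist_root (n : nat) (e s t : R) : (0 < n)%N -> 0 <= e ->
  0 <= s -> 0 <= t -> `|s ^+ n - t ^+ n| <= e ^+ n -> `|s - t| <= e.
Proof.
move=> n0 e0; wlog ts : s t / t <= s => [wl s0 t0 |s0 t0].
  have [ts|/ltW st] := leP t s; first exact: wl.
  by rewrite distrC [`|s - t|]distrC; exact: wl.
have super (a b : R) : 0 <= a -> 0 <= b -> a ^+ n + b ^+ n <= (a + b) ^+ n.
  move=> a0 b0; case: n n0 => // n _; rewrite exprDn big_ord_recl big_ord_recr /=.
  rewrite subn0 bin0 mulr1n expr0 mulr1 /bump /= add1n subnn binn expr0 mul1r mulr1n.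
  rewrite lerD2l lerDr sumr_ge0// => i _.
  by rewrite mulrn_wge0// mulr_ge0// exprn_ge0.
rewrite !ger0_norm ?subr_ge0//; last by rewrite lerXn2r.
move=> ste; rewrite -(@ler_pXn2r _ n)// ?nnegrE ?subr_ge0//.
apply: le_trans ste; rewrite lerBrDr.
by have := super (s - t) t; rewrite subrK subr_ge0; apply.
Qed.

Lemma ev_root (n : nat) x : (0 < n)%N -> uideal u x -> 0 <= x ->
  exists2 y, uideal u y & forall phi, uspec u phi ->
    0 <= phi y /\ phi y ^+ n = phi x.
Proof.
move=> n0 ux x0; have [c c0] := uideal_bound ux; rewrite vabs_pos// => xc.
pose rt (t : R) := t `^ n%:R^-1.
have rtK t : 0 <= t -> rt t ^+ n = t.
  move=> t0; rewrite /rt -powR_mulrn ?powR_ge0// -powRrM mulVf ?powRr1//.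
  by rewrite pnatr_eq0 -lt0n.
pose x' := c^-1 *: x.
have [||e e0|y uy yE] := @ev_calculus rt x'.
- by apply: vl_scale_ge0 => //; rewrite invr_ge0 ltW.
- by rewrite vleZV ?invr_gt0// invrK.
- exists (e ^+ n) => [|s t /andP[s0 _] /andP[t0 _] st]; first exact: exprn_gt0.
  apply: (expr_dist_root n0 (ltW e0)); rewrite ?powR_ge0//.
  by rewrite !rtK.
exists (rt c *: y); first exact: uidealZ.
move=> phi phiP; rewrite (evZ phiP)// yE//; split.
  by rewrite mulr_ge0 ?powR_ge0.
have phix' : phi x' = c^-1 * phi x by rewrite (evZ phiP).
rewrite exprMn (rtK c (ltW c0)) rtK phix'.
  by rewrite mulrA mulfV ?mul1r// gt_eqF.
by rewrite mulr_ge0 ?(ev_ge0 phiP)// invr_ge0 ltW.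
Qed.

End calculus.

(** * Functional calculus *)

(** The functional calculus is specified by homomorphisms on the sublattice
    generated by the arguments and the value. These extend to, and are restricted
    from, homomorphisms on a principal ideal, where existence and uniqueness are
    matters of pointwise computation. *)
Section functional_calculus.
Context {R : realType} {E : vlatticeType R}.
Hypothesis (archE : archimedean E).
Variables (s : nat) (omega : ('I_s -> R) -> R) (f : 'I_s -> E).
Implicit Types (g u : E).

Let gen g : set E := smallest vector_sublattice (range f `|` [set g]).

Lemma gen_sub g (M : set E) : vector_sublattice M ->
  (forall k, M (f k)) -> M g -> gen g `<=` M.
Proof.
move=> Ms Mf Mg; apply: smallest_sub => // x [[k _ <-]|->] //.
Qed.

Lemma gen_sublattice g : vector_sublattice (gen g).
Proof.
split.
- by move=> M [[]].
- by move=> a x y gx gy M MP; have [[_ + _ _] _] := MP; apply; [exact: gx|exact: gy].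
- by move=> x y gx gy M MP; have [[_ _ + _] _] := MP; apply; [exact: gx|exact: gy].
- by move=> x y gx gy M MP; have [[_ _ _ +] _] := MP; apply; [exact: gx|exact: gy].
Qed.

Lemma gen_f g k : gen g (f k).
Proof. by move=> M [_]; apply; left; exists k. Qed.

Lemma gen_g g : gen g g.
Proof. by move=> M [_]; apply; right. Qed.

Lemma is_fcalc_ev u g phi : (forall k, uideal u (f k)) -> uideal u g ->
  uspec u phi -> is_fcalc omega f g -> phi g = omega (phi \o f).
Proof.
move=> uf ug [[lin join meet] _]; apply.
have sub : gen g `<=` uideal u by apply: gen_sub => //; exact: uideal_sublattice.
split; [move=> a x y|move=> x y|move=> x y] => gx gy;
  by [apply: lin; exact: sub|apply: join; exact: sub|apply: meet; exact: sub].
Qed.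

(** Both candidates lie in the principal ideal of the element [u] below, whose
    spectrum separates them. *)
Lemma is_fcalc_unique g g' : is_fcalc omega f g -> is_fcalc omega f g' -> g = g'.
Proof.
move=> fg fg'; pose u := \sum_k vabs (f k) + (vabs g + vabs g').
have s0 : 0 <= \sum_k vabs (f k).
  by elim/big_ind : _ => // [|k _]; [exact: vaddr_ge0|exact: vabs_ge0].
have u0 : 0 <= u by rewrite !vaddr_ge0 ?vabs_ge0.
have sup h : vabs h <= u -> uideal u h by move=> hu; exists 1; rewrite scale1r.
have uf k : uideal u (f k).
  apply: sup; rewrite /u (bigD1 k)//= -addrA vler_addr// !vaddr_ge0 ?vabs_ge0//.
  by elim/big_ind : _ => // [|i _]; [exact: vaddr_ge0|exact: vabs_ge0].
have ug : uideal u g.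
  by apply: sup; rewrite /u addrC -addrA vler_addr// vaddr_ge0 ?vabs_ge0.
have ug' : uideal u g'.
  by apply: sup; rewrite /u addrA [leRHS]addrC vler_addr//; exact: vaddr_ge0 s0 (vabs_ge0 _).
apply: (ev_inj archE u0) => // phi phiP.
by rewrite (is_fcalc_ev uf ug phiP fg) (is_fcalc_ev uf ug' phiP fg').
Qed.

Lemma fcalc_eq g : is_fcalc omega f g -> fcalc omega f = g.
Proof. 
move=> fg; apply/esym/(is_fcalc_unique fg).
by apply: (@xgetPex _ 0 [set g | is_fcalc omega f g]); exists g.
 Qed.

Hypothesis omega0 : omega (fun=> 0) = 0.
Hypothesis omega_homogeneous : forall (c : R) (x : 'I_s -> R), 0 < c ->
  (forall k, 0 <= x k) -> omega (fun k => c * x k) = c * omega x.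
Hypothesis f_ge0 : forall k, 0 <= f k.

Let u := \sum_k f k.

Let u_ge0 : 0 <= u.
Proof. by rewrite /u; elim/big_ind : _ => //; exact: vaddr_ge0. Qed.

Let f_le k : f k <= u.
Proof.
rewrite /u (bigD1 k)//= vler_addr//.
by elim/big_ind : _ => //; exact: vaddr_ge0.
Qed.

Let uf k : uideal u (f k).
Proof. by apply: (@uideal_le _ _ _ _ 1) => //; rewrite scale1r. Qed.

(** It suffices to compute on the spectrum of [u]: a homomorphism on the generated
    sublattice either vanishes at [u], hence everywhere, or becomes the restriction
    of a point of the spectrum after division by its value at [u]; homogeneity of
    [omega] absorbs this factor. *)
Lemma fcalc_ev g : uideal u g ->
  (forall phi, uspec u phi -> phi g = omega (phi \o f)) -> fcalc omega f = g.
Proof.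
move=> ug gE; apply: fcalc_eq => psi psiP.
have sub : gen g `<=` uideal u by apply: gen_sub => //; exact: uideal_sublattice.
have [g0 glin gjoin gmeet] := gen_sublattice g.
have gu : gen g u.
  rewrite /u; elim/big_ind : _ => [//|x y gx gy|k _]; last exact: gen_f.
  by rewrite -[x]scale1r; exact: glin.
have [plin pjoin pmeet] := psiP.
have psi0 : psi 0 = 0.
  by have := plin (-1) 0 0 g0 g0; rewrite scaler0 addr0 mulN1r addNr.
have psiZ a x : gen g x -> psi (a *: x) = a * psi x.
  by move=> gx; rewrite -[_ *: _]addr0 plin// psi0 addr0.
have gZ a x : gen g x -> gen g (a *: x).
  by move=> gx; rewrite -[_ *: _]addr0; exact: glin.
have psi_le x y : gen g x -> gen g y -> x <= y -> psi x <= psi y.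
  by move=> gx gy xy; rewrite -(vjoin_id xy) pjoin// le_max lexx.
have psif k : 0 <= psi (f k) by rewrite -psi0 psi_le//; exact: gen_f.
have : 0 <= psi u by rewrite -psi0 psi_le.
rewrite le_eqVlt => /predU1P[pu0|pu0].
  have -> : psi \o f = fun=> 0.
    apply/funext => k /=; apply/le_anti; rewrite psif andbT pu0.
    by apply: psi_le => //; exact: gen_f.
  rewrite omega0; have [c gc] := ug; have gg : gen g g by exact: gen_g.
  have gN x : gen g x -> gen g (- x) by move=> gx; rewrite -scaleN1r; exact: gZ.
  move: gc; rewrite vabs_le => /andP[gc ngc].
  apply/le_anti/andP; split.
    by have := psi_le _ _ gg (gZ c _ gu) gc; rewrite psiZ// -pu0 mulr0.
  have := psi_le _ _ (gN _ gg) (gZ c _ gu) ngc; rewrite psiZ// -pu0 mulr0.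
  by rewrite -scaleN1r psiZ// mulN1r oppr_le0.
have [||||||phi phiP phiE] := @uspec_extend _ _ u (gen g) (fun x => (psi u)^-1 * psi x).
- exact: u_ge0.
- exact: gen_sublattice.
- exact: gu.
- exact: sub.
- split.
  + by move=> a x y gx gy; rewrite plin// mulrDr mulrCA.
  + by move=> x y gx gy; rewrite pjoin// maxr_pMr// invr_ge0 ltW.
  + by move=> x y gx gy; rewrite pmeet// minr_pMr// invr_ge0 ltW.
- by rewrite mulVf// gt_eqF.
have := gE _ phiP; rewrite phiE; last exact: gen_g.
have -> : phi \o f = fun k => (psi u)^-1 * (psi \o f) k.
  by apply/funext => k /=; rewrite phiE//; exact: gen_f.
rewrite omega_homogeneous ?invr_gt0//.
by apply: mulfI; rewrite invr_eq0 gt_eqF.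
Qed.

End functional_calculus.

(** * Multilinear maps *)

Section multilinear_theory.
Context {R : realType} {V W : lmodType R} {n : nat}.
Variable (T : ('I_n -> V) -> W).
Hypothesis (Tlin : multilinear T).
Implicit Types (x y f : 'I_n -> V).

Lemma mlinL f i a u v :
  T (dfwith f i (a *: u + v)) = a *: T (dfwith f i u) + T (dfwith f i v).
Proof. exact: (Tlin f i). Qed.

Lemma mlin0 f i : T (dfwith f i 0) = 0.
Proof.
by have := mlinL f i (-1) 0 0; rewrite scaler0 addr0 scaleN1r addNr.
Qed.

Lemma mlinD f i u v : T (dfwith f i (u + v)) = T (dfwith f i u) + T (dfwith f i v).
Proof. by rewrite -[u]scale1r mlinL !scale1r. Qed.

Lemma mlinZ f i a u : T (dfwith f i (a *: u)) = a *: T (dfwith f i u).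
Proof. by rewrite -[_ *: u]addr0 mlinL mlin0 addr0. Qed.

Lemma mlinB f i u v : T (dfwith f i (u - v)) = T (dfwith f i u) - T (dfwith f i v).
Proof. by rewrite mlinD -scaleN1r mlinZ scaleN1r. Qed.

Lemma dfwith_id f i : dfwith f i (f i) = f.
Proof. by apply/funext => j; case: dfwithP. Qed.

Lemma dfwithC f i j u v : i != j ->
  dfwith (dfwith f i u) j v = dfwith (dfwith f j v) i u.
Proof.
move=> ij; apply/funext => k; have [<-|ik] := eqVneq i k.
  by rewrite dfwithin dfwithout 1?eq_sym// dfwithin.
rewrite [RHS]dfwithout//; have [<-|jk] := eqVneq j k.
  by rewrite !dfwithin.
by rewrite !dfwithout.
Qed.

Lemma mlin_eq0 f i : f i = 0 -> T f = 0.
Proof. by move=> fi; rewrite -(dfwith_id f i) fi mlin0. Qed.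

Lemma mlin_sum_at f i (I : Type) (r : seq I) (F : I -> V) :
  T (dfwith f i (\sum_(k <- r) F k)) = \sum_(k <- r) T (dfwith f i (F k)).
Proof.
elim: r => [|k r IH]; first by rewrite !big_nil mlin0.
by rewrite !big_cons mlinD IH.
Qed.

Lemma mlin_scale (c : 'I_n -> R) x :
  T (fun j => c j *: x j) = (\prod_j c j) *: T x.
Proof.
rewrite -big_enum; have -> : (fun j => c j *: x j) =
    fun j => if j \in enum 'I_n then c j *: x j else x j.
  by apply/funext => j; rewrite mem_enum.
elim: (enum _) (enum_uniq 'I_n) => [_|i r IH /= /andP[ir /IH{}IH]].
  by rewrite big_nil scale1r.
rewrite big_cons -scalerA -IH -[in RHS](dfwith_id (fun j => if j \in r then _ else _) i).
rewrite (negbTE ir) -mlinZ; congr T; apply/funext => j.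
rewrite in_cons; have [->|ij] := eqVneq j i; first by rewrite dfwithin.
by rewrite dfwithout 1?eq_sym.
Qed.

(** Distributivity of a multilinear map over sums, one argument at a time. The
    arguments in [r] have been expanded; [k0] pads the choice functions outside
    of [r] so that they are counted once. *)
Lemma mlin_expand (I : finType) (k0 : I) (v : 'I_n -> I -> V) :
  T (fun j => \sum_k v j k) =
  \sum_(phi : {ffun 'I_n -> I}) T (fun j => v j (phi j)).
Proof.
pose Pf (r : seq 'I_n) := pfamily k0 (mem r) (fun _ => predT : pred I).
have claim (r : seq 'I_n) (x : 'I_n -> V) : uniq r ->
    T (fun j => if j \in r then \sum_k v j k else x j) =
    \sum_(phi in Pf r) T (fun j => if j \in r then v j (phi j) else x j).
  elim: r x => [|i r IH] x.
    move=> _; rewrite (big_pred1 [ffun=> k0]) //= => f.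
    apply/familyP/eqP => /= [Df|->{f} i]; last by rewrite ffunE !inE.
    by apply/ffunP => i; rewrite ffunE; apply/eqP/Df.
  move=> /= /andP[nri ur].
  have -> : (fun j => if j \in i :: r then \sum_k v j k else x j) =
      dfwith (fun j => if j \in r then \sum_k v j k else x j) i (\sum_k v i k).
    apply/funext => j; rewrite in_cons.
    by have [->|ij] := eqVneq j i; [rewrite dfwithin|rewrite dfwithout 1?eq_sym].
  rewrite mlin_sum_at (partition_big (fun f : {ffun 'I_n -> I} => f i) xpredT)//.
  apply: eq_bigr => k _.
  have -> : dfwith (fun j => if j \in r then \sum_k v j k else x j) i (v i k) =
      fun j => if j \in r then \sum_k v j k else dfwith x i (v i k) j.
    apply/funext => j; have [->|ij] := eqVneq j i.
      by rewrite !dfwithin (negbTE nri).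
    by rewrite !dfwithout 1?eq_sym.
  rewrite {}IH//.
  pose seti k (f : {ffun 'I_n -> I}) := [ffun j => if j == i then k else f j].
  rewrite [RHS](reindex_onto (seti k) (seti k0)) => [|f /andP[_ /eqP fi]]; last first.
    by apply/ffunP => j; rewrite !ffunE; case: eqP => // ->.
  apply: eq_big => [f|f Pff]; last first.
    congr T; apply/funext => j; rewrite in_cons ffunE.
    by have [->|ij] := eqVneq j i; [rewrite (negbTE nri) dfwithin|rewrite dfwithout 1?eq_sym].
  rewrite !ffunE !eqxx andbT; apply/familyP/andP => /= [Pff|[Pjf fij0] j].
    (split; [apply/familyP | apply/eqP/ffunP]) => j; have := Pff j; rewrite !(ffunE, inE).
      by case: eqP => // ->.
    by case: eqP => // ->; rewrite (negbTE nri) /= => /eqP.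
  have := familyP Pjf j; rewrite !(ffunE, inE); case: eqP => // -> _.
  by rewrite (negbTE nri) -(eqP fij0) !ffunE !inE !eqxx.
have := claim (enum 'I_n) (fun=> 0) (enum_uniq 'I_n).
have -> : (fun j => if j \in enum 'I_n then \sum_k v j k else 0) = fun j => \sum_k v j k.
  by apply/funext => j; rewrite mem_enum.
move=> ->; apply: eq_big => [f|f _].
  by apply/familyP => j; rewrite /= mem_enum.
by congr T; apply/funext => j; rewrite mem_enum.
Qed.

Lemma mlin_expand_bool x y : T (fun j => x j + y j) =
  \sum_(e : {ffun 'I_n -> bool}) T (fun j => if e j then y j else x j).
Proof.
rewrite -(mlin_expand false (fun j (b : bool) => if b then y j else x j)).
by congr T; apply/funext => j; rewrite big_bool addrC.
Qed.

Hypothesis (Tsym : symmetric_map T).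

Lemma mlin_perm_eq (x y : 'I_n -> V) :
  perm_eq [seq x i | i <- enum 'I_n] [seq y i | i <- enum 'I_n] -> T x = T y.
Proof.
have sz (z : 'I_n -> V) : size [seq z i | i <- enum 'I_n] == n.
  by rewrite size_map size_enum_ord.
move=> xy; have /tuple_permP[s xs] : perm_eq [seq x i | i <- enum 'I_n] (Tuple (sz y)) by [].
rewrite -(Tsym s y); congr T; apply/funext => i /=.
have := congr1 (fun z => nth 0 z i) xs.
rewrite (nth_map i) ?size_enum_ord// nth_ord_enum => ->.
rewrite (nth_map i) ?size_enum_ord// nth_ord_enum (tnth_nth 0) /=.
by rewrite (nth_map i) ?size_enum_ord// nth_ord_enum.
Qed.

(** Inclusion and exclusion. The sum factors over the indices [i]; the factor at
    [i] is one if [phi] takes the value [i], and zero otherwise. *)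
Lemma sum_sign_inj (phi : {ffun 'I_n -> 'I_n}) :
  \sum_(e : {ffun 'I_n -> bool}) (\prod_i (-1) ^+ ~~ e i) *
     \prod_j (e (phi j))%:R = (injectiveb phi)%:R :> R.
Proof.
transitivity (\sum_(e : {ffun 'I_n -> bool}) \prod_i
    (((-1) ^+ (~~ e i)) * \prod_(j | phi j == i) (e i)%:R) : R).
  apply: eq_bigr => e _; rewrite [RHS]big_split /=; congr *%R.
  rewrite (partition_big phi xpredT) //=; apply: eq_bigr => i _.
  by apply: eq_bigr => j /eqP ->.
rewrite -(bigA_distr_bigA (fun (i : 'I_n) (b : bool) =>
   ((-1) ^+ (~~ b)) * \prod_(j | phi j == i) b%:R)).
under eq_bigr => i _ do rewrite big_bool /= expr0 mul1r expr1 big1_eq mulN1r.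
have [inj|ninj] := boolP (injectiveb phi).
  rewrite big1// => i _.
  have : i \in codom phi by apply: inj_card_onto; [exact/injectiveP|].
  by move=> /codomP[j ->]; rewrite (bigD1 j)//= mul0r subr0.
have [i iphi] : exists i, i \notin codom phi.
  apply/existsP; rewrite -negb_forall; apply: contra ninj => /forallP onto.
  have /image_injP inj : #|image_mem phi (mem 'I_n)| == #|'I_n|.
    rewrite eqn_leq leq_image_card /=; apply/subset_leq_card/fintype.subsetP => j _.
    exact: onto.
  by apply/injectiveP => a b; exact: inj.
rewrite (bigD1 i)//= big_pred0 ?subrr ?mul0r// => j.
by apply/negP => /eqP phij; move/negP: iphi; apply; rewrite -phij; exact: codom_f.
Qed.

(** Expanding the right-hand side, only the terms in which every [x i] occurs
    exactly once survive by [sum_sign_inj]. *)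
Lemma polarization (x : 'I_n -> V) (i0 : 'I_n) : (n`!)%:R *: T x =
  \sum_(e : {ffun 'I_n -> bool}) (\prod_i (-1) ^+ ~~ e i) *:
    T (fun=> \sum_i (e i)%:R *: x i).
Proof.
have step (e : {ffun 'I_n -> bool}) : T (fun=> \sum_i (e i)%:R *: x i) =
    \sum_(phi : {ffun 'I_n -> 'I_n}) (\prod_j (e (phi j))%:R) *: T (fun j => x (phi j)).
  rewrite (mlin_expand i0 (fun _ i => (e i)%:R *: x i)); apply: eq_bigr => phi _.
  exact: (mlin_scale (fun j => (e (phi j))%:R)).
transitivity (\sum_(e : {ffun 'I_n -> bool}) \sum_(phi : {ffun 'I_n -> 'I_n})
    ((\prod_i (-1) ^+ ~~ e i) * \prod_j (e (phi j))%:R) *: T (fun j => x (phi j))); last first.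
  apply: eq_bigr => e _; rewrite step scaler_sumr.
  by apply: eq_bigr => phi _; rewrite scalerA.
rewrite exchange_big /=.
under eq_bigr => phi _ do rewrite -scaler_suml sum_sign_inj.
rewrite (bigID (fun phi : {ffun 'I_n -> 'I_n} => injectiveb phi)) /=.
rewrite [X in _ + X]big1 ?addr0; last first.
  by move=> phi /negbTE ->; rewrite scale0r.
transitivity (\sum_(phi : {ffun 'I_n -> 'I_n} | injectiveb phi) T x); last first.
  apply: eq_bigr => phi phi_inj; rewrite phi_inj scale1r.
  have /injectiveP inj := phi_inj.
  by rewrite -(Tsym (perm inj) x); congr T; apply/funext => j /=; rewrite permE.
rewrite sumr_const -[RHS]scaler_nat; congr (_%:R *: _).
have := card_inj_ffuns 'I_n 'I_n; rewrite card_ord ffactnn => <-.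
by apply: eq_card => phi; rewrite inE.
Qed.

End multilinear_theory.

(** * Boundedness *)

Section bornology.
Context {R : realType} {Y : convexBornType R}.
Implicit Types (B : set Y) (y : Y).

Lemma born_set0 : bornology [set 0 : Y].
Proof.
have : [set: Y] 0 by []. 
rewrite -(@born_cover _ Y) => -[A Ab A0].
by apply: born_subset Ab => _ ->.
Qed.

Lemma born_lincomb (I : Type) (r : seq I) (c : I -> R) B : bornology B ->
  bornology [set y | exists2 b : I -> Y, (forall i, B (b i)) & y = \sum_(i <- r) c i *: b i].
Proof.
move=> Bb; elim: r => [|i r IH].
  by apply: (@born_subset _ _ _ _ _ born_set0) => y [b _ ->]; rewrite big_nil.
apply: (@born_subset _ _ _ _ _ (born_add _ _ (born_scale (c i) _ Bb) IH)) => y [b bB ->].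
rewrite big_cons; exists (c i *: b i); first by exists (b i).
by exists (\sum_(j <- r) c j *: b j) => //; exists b.
Qed.

(** If [y] lies in all the sets [B / N], then the line through [y] lies in the
    circled hull of [B] and is bounded, so it is zero by separation. This replaces
    the limit arguments that a norm would permit. *)
Lemma born_absorbed_eq0 B y : bornology B ->
  (forall N : nat, exists2 b, B b & y = N.+1%:R^-1 *: b) -> y = 0.
Proof.
move=> Bb small; pose V := [set a *: y | a in [set: R]].
have V0 : V 0 by exists 0 => //; rewrite scale0r.
have Vlin (a : R) x z : V x -> V z -> V (a *: x + z).
  move=> [b _ <-] [c _ <-]; exists (a * b + c) => //.
  by rewrite scalerDl scalerA.
have Vb : bornology V.
  apply: (@born_subset _ _ _ _ _ (born_circled _ Bb)) => _ [a _ <-].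
  have [b bB ->] := small (Num.bound a).
  exists (a / (Num.bound a).+1%:R); last by exists b => //; rewrite scalerA.
  rewrite /= normrM normfV normr_nat ler_pdivrMr ?ltr0n// mul1r.
  apply: le_trans (ltW (archi_boundP (normr_ge0 a))) _.
  by rewrite /Num.bound normr_id ler_nat.
have : V y by exists 1 => //; rewrite scale1r.
by rewrite (born_separated _ V0 Vlin Vb).
Qed.

End bornology.

Section bounded_polynomial.
Context {R : realType} {E : vlatticeType R} {Y : convexBornType R} {n : nat}.
Variables (P : E -> Y) (T : ('I_n -> E) -> Y).
Hypotheses (n_gt0 : (0 < n)%N) (PT : homogeneous_polynomial P T).
Hypothesis (Pb : bounded_map P).

Lemma vabs_sum (I : Type) (r : seq I) (F : I -> E) :
  vabs (\sum_(i <- r) F i) <= \sum_(i <- r) vabs (F i).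
Proof.
elim: r => [|i r IH]; first by rewrite !big_nil vabs_pos.
by rewrite !big_cons; apply: le_trans (vabsD _ _) _; rewrite vleD2l.
Qed.

(** By polarization the values of [T] on a box are combinations of values of [P] on
    an order interval. *)
Lemma mlin_bounded (u : E) : 0 <= u ->
  bornology [set T x | x in [set x : 'I_n -> E | forall i, vabs (x i) <= u]].
Proof.
move=> u0; have [Tlin Tsym PE] := PT.
pose A := [set f : E | vabs f <= n%:R *: u].
have Ab : order_bounded A.
  exists (- (n%:R *: u)), (n%:R *: u) => f; rewrite /A /= vabs_le => /andP[h1 h2].
  by rewrite vleNl h2.
apply: (@born_subset _ _ _ _ _ (born_lincomb (index_enum {ffun 'I_n -> bool})
  (fun e => (n`!)%:R^-1 * \prod_i (-1) ^+ ~~ e i) (Pb Ab))) => _ [x xu <-].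
exists (fun e : {ffun 'I_n -> bool} => P (\sum_i (e i)%:R *: x i)) => [e|].
  exists (\sum_i (e i)%:R *: x i) => //=.
  apply: le_trans (vabs_sum _ _) _.
  apply: (@le_trans _ _ (\sum_(i < n) u)); last first.
    by rewrite sumr_const card_ord scaler_nat.
  elim/big_ind2 : _ => // [*|i _]; first exact: vleD.
  apply: le_trans (vabsZ_le _ _) _; apply: le_trans (xu i).
  rewrite -[leRHS]scale1r vleZr ?vabs_ge0//.
  by case: (e i); rewrite ?normr1 ?normr0.
have n0 : (n`!)%:R != 0 :> R by rewrite pnatr_eq0 -lt0n fact_gt0.
apply: (scalerI n0); rewrite (polarization Tlin Tsym x (Ordinal n_gt0)) scaler_sumr.
by apply: eq_bigr => e _; rewrite scalerA mulrA mulfV// mul1r PE.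
Qed.

End bounded_polynomial.

(** * Orthosymmetric maps factor through the pointwise product *)

Lemma nat_dist_cases (R : realDomainType) (i j : nat) : `|i%:R - j%:R| <= 1 :> R ->
  [\/ j%:R - i%:R = 1 :> R, j%:R - i%:R = -1 :> R | j%:R - i%:R = 0 :> R].
Proof.
rewrite distrC; have -> : j%:R - i%:R = (j%:Z - i%:Z)%:~R :> R by rewrite intrB.
rewrite -intr_norm -[1]/(1%:~R) ler_int => ij.
have /or3P[/eqP->|/eqP->|/eqP->] :
    [|| j%:Z - i%:Z == 1, j%:Z - i%:Z == -1 | j%:Z - i%:Z == 0] by lia.
- exact: Or31.
- exact: Or32.
- exact: Or33.
Qed.

Lemma nat_dist_le1 (R : realDomainType) (i j : nat) :
  `|i%:R - j%:R| < 2 :> R -> `|i%:R - j%:R| <= 1 :> R.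
Proof.
have -> : i%:R - j%:R = (i%:Z - j%:Z)%:~R :> R by rewrite intrB.
rewrite -intr_norm -[1]/(1%:~R) -[2]/(2%:~R) ltr_int ler_int.
by move: (i%:Z - j%:Z) => k; lia.
Qed.

(** A bounded bilinear map that vanishes on disjoint pairs depends only on the
    pointwise product. For a measure supported on the diagonal this would be
    evident, but a bounded bilinear map need not be given by a measure, and one has
    to avoid estimating a number of small terms that grows with the partition. Let
    [0 <= y <= u] and let [d i], for [i <= N], be hats of [N *: y], so that [u] is the
    sum of the [d i] and [N *: y] is the sum of the [i *: d i]. Then [N] times
    [B x y - B z u] is the double sum of [(j - i) *: B (x * d i) (d j)], in which
    only terms with [`|i - j| <= 1] are nonzero. For these [j - i] equals
    [sin ((j - i) * pi / 2)], which by the addition formula splits the double sum into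
    two values of [B] at arguments that are bounded independently of [N]. *)
Section bilinear.
Context {R : realType} {E : vlatticeType R} {Y : convexBornType R}.
Hypothesis (archE : archimedean E) (compE : uniformly_complete E).
Variable (u : E).
Hypothesis (u_ge0 : 0 <= u).
Variable (B : E -> E -> Y).
Hypothesis Bl : forall y, linear (B^~ y).
Hypothesis Br : forall x, linear (B x).
Hypothesis B_disjoint : forall x y, vdisjoint x y -> B x y = 0.
Hypothesis B_bounded : forall v, 0 <= v ->
  bornology [set t | exists x y, [/\ vabs x <= v, vabs y <= v & t = B x y]].
Implicit Types (x y z : E).

Let Bl0 y : B 0 y = 0.
Proof. by have := Bl y (-1) 0 0; rewrite scaler0 addr0 scaleN1r addNr. Qed.

Let Br0 x : B x 0 = 0.
Proof. by have := Br x (-1) 0 0; rewrite scaler0 addr0 scaleN1r addNr. Qed.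

Let BlZ a x y : B (a *: x) y = a *: B x y.
Proof. by have := Bl y a x 0; rewrite /= !addr0 Bl0 addr0. Qed.

Let BrZ a x y : B x (a *: y) = a *: B x y.
Proof. by have := Br x a y 0; rewrite /= !addr0 Br0 addr0. Qed.

Let BlD x x' y : B (x + x') y = B x y + B x' y.
Proof. by have := Bl y 1 x x'; rewrite /= !scale1r. Qed.

Let BrD x y y' : B x (y + y') = B x y + B x y'.
Proof. by have := Br x 1 y y'; rewrite /= !scale1r. Qed.

Let B_sum (N : nat) (a b : 'I_N -> R) (x y : 'I_N -> E) :
  B (\sum_i a i *: x i) (\sum_j b j *: y j) =
  \sum_i \sum_j (a i * b j) *: B (x i) (y j).
Proof.
rewrite (big_morph (B^~ _) (id1 := 0) (op1 := +%R)); [|by move=> *; exact: BlD|exact: Bl0].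
apply: eq_bigr => i _.
rewrite (big_morph (B _) (id1 := 0) (op1 := +%R)); [|by move=> *; exact: BrD|exact: Br0].
by apply: eq_bigr => j _; rewrite BlZ BrZ scalerA.
Qed.

Let norm_sum_hat (N : nat) (s : R) (a : nat -> R) : 0 <= s <= N%:R ->
  (forall i, `|a i| <= 1) -> `|\sum_(i < N.+1) a i * hat (s - i%:R)| <= 1.
Proof.
move=> sN a1; rewrite -[leRHS](sum_hat sN); apply: le_trans (ler_norm_sum _ _ _) _.
apply: ler_sum => i _; rewrite normrM (ger0_norm (hat_ge0 _)).
by rewrite ler_piMl ?hat_ge0.
Qed.

(* The sine of a multiple of [pi / 2] agrees with the integer factor when the
   latter is -1, 0 or 1. *)
Let wedge (i j : nat) : `|i%:R - j%:R| <= 1 :> R ->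
  cos (i%:R * (pi / 2)) * sin (j%:R * (pi / 2)) -
  sin (i%:R * (pi / 2)) * cos (j%:R * (pi / 2)) = j%:R - i%:R :> R.
Proof.
move=> ij.
have -> : cos (i%:R * (pi / 2)) * sin (j%:R * (pi / 2)) -
  sin (i%:R * (pi / 2)) * cos (j%:R * (pi / 2)) = sin ((j%:R - i%:R) * (pi / 2)) :> R.
  by rewrite mulrBl sinB; ring.
case: (nat_dist_cases ij).
- by move=> ->; rewrite mul1r sin_pihalf.
- by move=> ->; rewrite mulN1r sinN sin_pihalf.
- by move=> ->; rewrite mul0r sin0.
Qed.

Let local_box x y z : uideal u x -> 0 <= y -> y <= u -> uideal u z ->
  (forall phi, uspec u phi -> phi z = phi x * phi y) -> B x y = B z u.
Proof.
move=> ux y0 yu uz zE; have uy := uideal_box y0 yu.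
have uu := uideal_unit u_ge0.
have [c c0 xc] := uideal_bound u_ge0 ux.
apply/eqP; rewrite -subr_eq0; apply/eqP.
pose v := (c + 1) *: u.
have v0 : 0 <= v by rewrite vl_scale_ge0// addr_ge0// ltW.
have Bb := B_bounded v0.
apply: (born_absorbed_eq0 (born_add _ _ Bb (born_scale (-1) _ Bb))) => n.
pose N := n.+1.
pose d (i : nat) := vlayer u N y i.
have ud i : uideal u (d i) by exact: uideal_vlayer.
have dE i phi : uspec u phi -> phi (d i) = hat (N%:R * phi y - i%:R).
  by move=> phiP; rewrite ev_vlayer.
have /choice[xd xdP] : forall i : nat, exists t, uideal u t /\
    forall phi, uspec u phi -> phi t = phi x * phi (d i).
  by move=> i; have [t ut tE] := ev_mul archE compE u_ge0 ux (ud i); exists t.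
have uxd i : uideal u (xd i) by have [] := xdP i.
have xdE i phi : uspec u phi -> phi (xd i) = phi x * hat (N%:R * phi y - i%:R).
  by move=> phiP; have [_ ->] := xdP i; rewrite ?dE.
have yN phi : uspec u phi -> 0 <= N%:R * phi y <= N%:R.
  by move=> /(ev_box u_ge0 y0 yu)/andP[t0 t1]; rewrite mulr_ge0//= ger_pMr// ltr0n.
pose S (a : nat -> R) (w : nat -> E) := \sum_(i < N.+1) a i *: w i.
have uS a w : (forall i, uideal u (w i)) -> uideal u (S a w).
  by move=> uw; apply: uideal_sum => i _; exact: uidealZ.
have SE a w phi : (forall i, uideal u (w i)) -> uspec u phi ->
    phi (S a w) = \sum_(i < N.+1) a i * phi (w i).
  move=> uw phiP; rewrite (ev_sum phiP) => [|i]; last exact: uidealZ.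
  by apply: eq_bigr => i _; rewrite (evZ phiP).
have sumd : S (fun=> 1) d = u.
  apply: (ev_inj archE u_ge0) => // [|phi phiP]; first exact: uS.
  rewrite SE// (ev_unit phiP) -[RHS](sum_hat (yN _ phiP)).
  by apply: eq_bigr => i _; rewrite mul1r dE.
have sumid : S (fun i => i%:R) d = N%:R *: y.
  apply: (ev_inj archE u_ge0) => [||phi phiP]; [exact: uS|exact: uidealZ|].
  rewrite SE// (evZ phiP)// -[RHS](sum_nat_hat (yN _ phiP)).
  by apply: eq_bigr => i _; rewrite dE.
have sumxd : S (fun=> 1) xd = x.
  apply: (ev_inj archE u_ge0) => // [|phi phiP]; first exact: uS.
  rewrite SE// -[RHS]mulr1 -[X in _ = _ * X](sum_hat (yN _ phiP)) mulr_sumr.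
  by apply: eq_bigr => i _; rewrite mul1r xdE.
have sumixd : S (fun i => i%:R) xd = N%:R *: z.
  apply: (ev_inj archE u_ge0) => [||phi phiP]; [exact: uS|exact: uidealZ|].
  rewrite SE// (evZ phiP)// zE// mulrCA -[X in _ * X](sum_nat_hat (yN _ phiP)) mulr_sumr.
  by apply: eq_bigr => i _; rewrite xdE// mulrCA.
pose cs (i : nat) : R := cos (i%:R * (pi / 2)).
pose sn (i : nat) : R := sin (i%:R * (pi / 2)).
have norm_xd a : (forall i, `|a i| <= 1) -> vabs (S a xd) <= v.
  move=> a1; apply/(ev_normP archE u_ge0); first exact: uS.
  move=> phi phiP; rewrite SE//.
  have -> : \sum_(i < N.+1) a i * phi (xd i) =
      phi x * \sum_(i < N.+1) a i * hat (N%:R * phi y - i%:R).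
    by rewrite mulr_sumr; apply: eq_bigr => i _; rewrite xdE// mulrCA.
  rewrite normrM -[leRHS]mulr1; apply: ler_pM => //; last exact: norm_sum_hat (yN _ phiP) a1.
  apply: (@le_trans _ _ c); last by rewrite lerDl.
  by move: phi phiP; apply/(ev_normP archE u_ge0 c ux).
have norm_d a : (forall i, `|a i| <= 1) -> vabs (S a d) <= v.
  move=> a1; apply/(ev_normP archE u_ge0); first exact: uS.
  move=> phi phiP; rewrite SE//; apply: (@le_trans _ _ 1); last by rewrite lerDr ltW.
  under eq_bigr => i _ do rewrite dE//.
  exact: norm_sum_hat (yN _ phiP) a1.
have cs1 i : `|cs i| <= 1 by rewrite ler_norml cos_geN1 cos_le1.
have sn1 i : `|sn i| <= 1 by rewrite ler_norml sin_geN1 sin_le1.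
exists (B (S cs xd) (S sn d) + (-1) *: B (S sn xd) (S cs d)).
  exists (B (S cs xd) (S sn d)).
    by exists (S cs xd), (S sn d); split => //; [exact: norm_xd|exact: norm_d].
  exists ((-1) *: B (S sn xd) (S cs d)) => //.
  exists (B (S sn xd) (S cs d)) => //.
  by exists (S sn xd), (S cs d); split => //; [exact: norm_xd|exact: norm_d].
have N0 : N%:R != 0 :> R by rewrite pnatr_eq0.
apply: (scalerI N0); rewrite scalerA mulfV// scale1r scalerBr -BrZ -BlZ.
rewrite -[in B x _]sumxd -[in B (S _ _) _]sumid -sumixd -[in B _ u]sumd !B_sum.
rewrite -sumrB scaleN1r -sumrB; apply: eq_bigr => i _.
rewrite -!sumrB; apply: eq_bigr => j _; rewrite -!scalerBl mul1r mulr1.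
have [near|far] := leP `|i%:R - j%:R| (1 : R).
  by rewrite -(wedge near) /cs /sn.
rewrite B_disjoint ?scaler0//.
apply: (ev_disjoint archE u_ge0) => // phi phiP; rewrite xdE// dE//.
set t := N%:R * phi y.
have [ti|ti] := leP 1 `|t - i%:R|; first by left; rewrite hat_eq0 ?mulr0.
right; apply: hat_eq0; rewrite leNgt; apply/negP => tj.
move: far; apply/negP; rewrite -leNgt nat_dist_le1//.
have -> : i%:R - j%:R = (t - j%:R) - (t - i%:R) by ring.
by apply: le_lt_trans (ler_normB _ _) _; rewrite -[2]/(1 + 1) ltrD.
Qed.

(** Both sides are affine in [y], which reduces the claim to [0 <= y <= u]. *)
Lemma bilinear_local x y z : uideal u x -> uideal u y -> uideal u z ->
  (forall phi, uspec u phi -> phi z = phi x * phi y) -> B x y = B z u.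
Proof.
move=> ux uy uz zE; have uu := uideal_unit u_ge0.
have [c c0 /=] := uideal_rescale u_ge0 uy; set y' := _ *: _ => -[y'0 y'u].
have uy' := uideal_box y'0 y'u.
have [z' uz' z'E] := ev_mul archE compE u_ge0 ux uy'.
have c2 : 2 * c != 0 by rewrite mulf_neq0// gt_eqF.
have yE : y = (2 * c) *: y' - c *: u.
  by rewrite /y' scalerA mulfV// scale1r addrK.
have -> : z = (2 * c) *: z' - c *: x.
  apply: (ev_inj archE u_ge0) => // [|phi phiP].
    by apply: uidealB; exact: uidealZ.
  have uyy := uidealZ (2 * c) uy'; have ucu := uidealZ c uu.
  have uzz := uidealZ (2 * c) uz'; have ucx := uidealZ c ux.
  rewrite zE// (evB phiP)// (evZ phiP)// (evZ phiP)// z'E//.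
  have -> : phi y = 2 * c * phi y' - c.
    by rewrite {1}yE (evB phiP)// (evZ phiP _ uy') (evZ phiP _ uu) (ev_unit phiP) mulr1.
  by ring.
have /eqP := local_box ux y'0 y'u uz' z'E.
rewrite {1}yE -!scaleNr BrD BlD !BrZ !BlZ => /eqP ->.
by [].
Qed.

End bilinear.

Section factorization.
Context {R : realType} {E : vlatticeType R} {Y : convexBornType R} {n : nat}.
Hypothesis (archE : archimedean E) (compE : uniformly_complete E).
Variables (P : E -> Y) (T : ('I_n -> E) -> Y).
Hypotheses (PT : homogeneous_polynomial P T) (Pb : bounded_map P).
Implicit Types (f x : 'I_n -> E) (u : E).

Let Tlin : multilinear T. Proof. by case: PT. Qed.

Lemma vsum_ge0 (I : Type) (r : seq I) (Q : pred I) (F : I -> E) :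
  (forall i, 0 <= F i) -> 0 <= \sum_(i <- r | Q i) F i.
Proof. by move=> F0; elim/big_ind : _ => //; exact: vaddr_ge0. Qed.

Lemma vle_sum (I : finType) (F : I -> E) i :
  (forall i, 0 <= F i) -> F i <= \sum_j F j.
Proof. by move=> F0; rewrite (bigD1 i)//= vler_addr// vsum_ge0. Qed.

Lemma uideal_sum_ge0 (I : finType) (F : I -> E) i :
  (forall i, 0 <= F i) -> uideal (\sum_j F j) (F i).
Proof.
by move=> F0; apply: (@uideal_le _ _ _ _ 1) => //; rewrite scale1r vle_sum.
Qed.

Hypothesis Torth : orthosymmetric T.

(** [bilinear_local] applied to the two arguments [i] and [j], the others being
    frozen. *)
Lemma mlin_local u f i j z : 0 <= u -> i != j -> (forall k, uideal u (f k)) ->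
  uideal u z -> (forall phi, uspec u phi -> phi z = phi (f i) * phi (f j)) ->
  T f = T (dfwith (dfwith f i z) j u).
Proof.
move=> u0 ij uf uz zE.
pose B (y1 y2 : E) := T (dfwith (dfwith f i y1) j y2).
have -> : T f = B (f i) (f j) by rewrite /B !dfwith_id.
apply: (@bilinear_local _ _ _ archE compE u u0 B) => //.
- by move=> y a x x'; rewrite /B ![dfwith (dfwith f i _) j y]dfwithC// mlinL.
- by move=> x a y y'; rewrite /B mlinL.
- move=> x y xy; apply: Torth; exists i, j.
  by rewrite dfwithin dfwithout 1?eq_sym// dfwithin.
move=> v v0; pose w := v + \sum_k vabs (f k).
have S0 : 0 <= \sum_k vabs (f k) by apply: vsum_ge0 => k; exact: vabs_ge0.
have w0 : 0 <= w by exact: vaddr_ge0.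
have n0 : (0 < n)%N by exact: leq_ltn_trans (ltn_ord i).
apply: (@born_subset _ _ _ _ _ (mlin_bounded n0 PT Pb w0)).
move=> _ [x [y [xv yv ->]]]; exists (dfwith (dfwith f i x) j y) => // k.
have [<-|jk] := eqVneq j k; first by rewrite dfwithin vler_addr.
rewrite dfwithout//; have [<-|ik] := eqVneq i k; first by rewrite dfwithin vler_addr.
rewrite dfwithout// /w addrC vler_addr//.
by apply: (@vle_sum _ (fun k => vabs (f k))) => l; exact: vabs_ge0.
Qed.

(** All arguments are moved into the slot [i0], one at a time, leaving [u]
    behind. Hence the value of [T] is a linear function of the pointwise product of
    its arguments. *)
Lemma mlin_factor u f i0 h : 0 <= u -> (forall k, uideal u (f k)) ->
  uideal u h -> (forall phi, uspec u phi -> phi h = \prod_k phi (f k)) ->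
  T f = T (dfwith (fun=> u) i0 h).
Proof.
move=> u0; have uu := uideal_unit u0.
have [m] := ubnP #|[pred i | (i != i0) && (f i != u)]|.
elim: m f => // m IH f mf uf uh hE.
have [i /andP[/= ii0 fiu]|no] := pickP [pred i | (i != i0) && (f i != u)]; last first.
  congr T; apply/funext => k.
  have fu i : i != i0 -> f i = u.
    by move=> ii0; apply/eqP; have := no i; rewrite /= ii0 => /negbFE.
  have [<-|i0k] := eqVneq i0 k; last by rewrite dfwithout// fu// eq_sym.
  rewrite dfwithin; apply: (ev_inj archE u0) => // phi phiP.
  rewrite hE// (bigD1 i0)//= big1 ?mulr1// => i ii0.
  by rewrite fu// (ev_unit phiP).
have i0i : i0 != i by rewrite eq_sym.
have [z uz zE] := ev_mul archE compE u0 (uf i0) (uf i).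
rewrite (mlin_local u0 i0i uf uz zE); apply: IH => //.
- rewrite -ltnS; apply: leq_trans mf; rewrite ltnS; apply: proper_card.
  apply/properP; split.
    apply/fintype.subsetP => k; rewrite !inE => /andP[ki0 fk]; rewrite ki0 /=.
    move: fk; have [<-|ik] := eqVneq i k; first by rewrite dfwithin eqxx.
    by rewrite !dfwithout// eq_sym.
  by exists i; rewrite !inE ?ii0 ?fiu// dfwithin eqxx.
- move=> k; have [<-|ik] := eqVneq i k; first by rewrite dfwithin.
  rewrite dfwithout//; have [<-|i0k] := eqVneq i0 k; first by rewrite dfwithin.
  by rewrite dfwithout.
- move=> phi phiP; rewrite hE//.
  rewrite (bigD1 i0)//= (bigD1 i)//= [RHS](bigD1 i0)//= [X in _ = _ * X](bigD1 i)//=.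
  rewrite dfwithin dfwithout 1?eq_sym// dfwithin (ev_unit phiP) mul1r mulrA zE//.
  congr (_ * _); apply: eq_bigr => k /andP[ki0 ki].
  by rewrite !dfwithout// eq_sym.
Qed.

End factorization.

(** * From additivity to orthosymmetry *)

(** Positive and negative parts inherit disjointness, and [T] of an n-tuple is a
    signed sum of values at tuples of such parts. *)
Lemma positive_orthosymmetric (R : realType) (E : vlatticeType R) (Y : lmodType R)
    n (T : ('I_n -> E) -> Y) : multilinear T ->
  (forall (x : 'I_n -> E) i j, (forall k, 0 <= x k) -> vdisjoint (x i) (x j) ->
    T x = 0) -> orthosymmetric T.
Proof.
move=> Tlin Tpos f [i [j fij]].
have -> : f = fun k => vjoin (f k) 0 + (- vjoin (- f k) 0).
  by apply/funext => k; rewrite vpos_negB.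
rewrite (mlin_expand_bool Tlin) big1// => e _.
pose g k := if e k then vjoin (- f k) 0 else vjoin (f k) 0.
have -> : (fun k => if e k then - vjoin (- f k) 0 else vjoin (f k) 0) =
    fun k => (-1) ^+ e k *: g k.
  apply/funext => k; rewrite /g.
  by case: (e k); rewrite ?expr1 ?scaleN1r ?expr0 ?scale1r.
have g0 k : 0 <= g k by rewrite /g; case: ifP => _; exact: vjoinr.
have gf k : g k <= vabs (f k) by rewrite /g; case: ifP => _; [exact: vneg_abs|exact: vpos_abs].
rewrite (mlin_scale Tlin (fun k => (-1) ^+ e k)).
rewrite (Tpos g i j) ?scaler0//.
apply/le_anti; rewrite !vabs_pos// vmeetP !g0 andbT -fij vmeetP.
by rewrite (le_trans (vmeetl _ _))// (le_trans (vmeetr _ _)).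
Qed.

Lemma between_two (R : realFieldType) (lo hi : R) : lo < hi ->
  exists m1 m2, [/\ lo < m1, m1 < m2 & m2 < hi].
Proof.
by move=> lohi; exists ((2 * lo + hi) / 3), ((lo + 2 * hi) / 3); split; lra.
Qed.

Lemma threshold_dist (R : realFieldType) (t e : R) : 0 <= t -> 0 <= e ->
  `|t - Num.max (t - e) 0| <= e.
Proof. by move=> t0 e0; have [h|h] := leP (t - e) 0; rewrite ger0_norm; lra. Qed.

Section positive_additivity.
Context {R : realType} {E : vlatticeType R} {Y : convexBornType R} {n : nat}.
Hypothesis (archE : archimedean E) (compE : uniformly_complete E).
Variables (P : E -> Y) (T : ('I_n -> E) -> Y).
Hypotheses (PT : homogeneous_polynomial P T) (Pb : bounded_map P).
Hypothesis (Padd : positively_orthogonally_additive P).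
Implicit Types (f x : 'I_n -> E) (u : E).

Let Tlin : multilinear T. Proof. by case: PT. Qed.
Let Tsym : symmetric_map T. Proof. by case: PT. Qed.

(** Flipping the value of [e] at [j0] reverses the sign of every term. *)
Lemma sum_sign_flip (F : {ffun 'I_n -> bool} -> Y) j0 :
  (forall e e' : {ffun 'I_n -> bool}, (forall i, i != j0 -> e i = e' i) -> F e = F e') ->
  \sum_(e : {ffun 'I_n -> bool}) (\prod_i ((-1) ^+ (~~ e i) : R)) *: F e = 0.
Proof.
move=> Fj0; pose flip (e : {ffun 'I_n -> bool}) := [ffun j => if j == j0 then ~~ e j else e j].
have flipK : involutive flip.
  by move=> e; apply/ffunP => j; rewrite !ffunE; case: eqP => // _; rewrite negbK.
set S := \sum_(e : {ffun 'I_n -> bool}) _.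
suff SN : S = - S.
  have : 2 *: S = 0 by rewrite scaler_nat mulr2n {1}SN addNr.
  by move/eqP; rewrite scaler_eq0 pnatr_eq0 /= => /eqP.
rewrite {1}/S (reindex_inj (inv_inj flipK)) /= -sumrN; apply: eq_bigr => e _.
rewrite (Fj0 _ e) => [|i ij0]; last by rewrite ffunE (negbTE ij0).
rewrite -scaleNr (bigD1 j0)//= [in RHS](bigD1 j0)//= ffunE eqxx negbK -mulNr.
congr (_ * _ *: _); first by case: (e j0); rewrite ?expr0 ?expr1 ?opprK.
by apply: eq_bigr => i ij0; rewrite ffunE (negbTE ij0).
Qed.

(** In the polarization formula each sum of arguments is split into its two
    disjoint sides, on which [P] is additive. Either summand ignores the indices
    of the other side, so the alternating sum vanishes by [sum_sign_flip]. *)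
Lemma mlin_split_eq0 x (side : pred 'I_n) i0 j0 : (forall i, 0 <= x i) ->
  side i0 -> ~~ side j0 ->
  (forall i j, side i -> ~~ side j -> vdisjoint (x i) (x j)) -> T x = 0.
Proof.
move=> x0 si0 sj0 disj.
have n0 : (n`!)%:R != 0 :> R by rewrite pnatr_eq0 -lt0n fact_gt0.
apply: (scalerI n0); rewrite scaler0 (polarization Tlin Tsym x i0).
pose part (e : {ffun 'I_n -> bool}) (b : bool) := \sum_(i | side i == b) (e i)%:R *: x i.
have part0 e b : 0 <= part e b.
  by apply: vsum_ge0 => i; apply: vl_scale_ge0 => //; rewrite ler0n.
have PE (e : {ffun 'I_n -> bool}) : T (fun=> \sum_i (e i)%:R *: x i) = P (part e true) + P (part e false).
  have [_ _ TP] := PT; rewrite -TP -Padd//.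
    rewrite (bigID side) /=; congr P; congr +%R; apply: eq_bigl => i.
      by rewrite eqb_id.
    by rewrite eqbF_neg.
  pose u := \sum_i x i; have u0 : 0 <= u by exact: vsum_ge0.
  have ux i : uideal u (x i) by exact: uideal_sum_ge0.
  have up b : uideal u (part e b) by apply: uideal_sum => i _; exact: uidealZ.
  apply: (ev_disjoint archE u0) => // phi phiP.
  have ev b : (forall i, side i == b -> phi (x i) = 0) -> phi (part e b) = 0.
    move=> z; rewrite /part big_mkcond (ev_sum phiP) => [|i]; last first.
      by case: ifP => _; [exact: uidealZ|exact: uideal0].
    rewrite big1// => i _; case: ifP => [sb|_]; last exact: (ev0 phiP).
    by rewrite (evZ phiP)// z// mulr0.
  have [all0|] := pselect (forall i, side i == true -> phi (x i) = 0).
    by left; exact: ev.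
  move=> /existsNP[i /not_implyP[/eqP si phii]]; right; apply: ev => j.
  rewrite eqbF_neg => sj.
  by have [] := disjoint_ev (ux i) (ux j) phiP (disj _ _ si sj).
under eq_bigr => e _ do rewrite PE scalerDr.
rewrite big_split /= (sum_sign_flip (j0 := j0)) ?(sum_sign_flip (j0 := i0)) ?addr0//.
  move=> e e' ee'; congr P; apply: eq_bigr => i; rewrite eqbF_neg => si.
  by rewrite ee'//; apply: contraNneq si => ->.
move=> e e' ee'; congr P; apply: eq_bigr => i; rewrite eqb_id => si.
by rewrite ee'//; apply: contraTneq si => ->.
Qed.

(** Arguments are allowed that meet both sides, provided that the sides are
    separated by a gap of a function [w]: arguments on the left live where
    [hi <= w], those on the right where [w <= lo]. An arbitrary argument (its index
    is in [s]) is cut along a ramp inside the gap into one part for either side;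
    the gap shrinks but stays positive, and the number of arbitrary arguments
    decreases. *)
Lemma mlin_separated_eq0 u w (s : seq 'I_n) x (side : pred 'I_n) (lo hi : R) i0 j0 :
  0 <= u -> uideal u w -> (forall i, 0 <= x i) -> (forall i, uideal u (x i)) ->
  lo < hi ->
  (forall i, i \notin s -> side i -> forall phi, uspec u phi -> phi w < hi -> phi (x i) = 0) ->
  (forall i, i \notin s -> ~~ side i -> forall phi, uspec u phi -> lo < phi w -> phi (x i) = 0) ->
  i0 \notin s -> j0 \notin s -> side i0 -> ~~ side j0 -> T x = 0.
Proof.
move=> u0 uw; have uu := uideal_unit u0.
elim: s x side lo hi => [|i s IH] x side lo hi x0 ux lohi left right i0s j0s si0 sj0.
  apply: (mlin_split_eq0 x0 si0 sj0) => i j si sj.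
  apply: (ev_disjoint archE u0) => // phi phiP.
  have [wh|wh] := ltP (phi w) hi; first by left; exact: (left i).
  by right; apply: (right j) => //; exact: lt_le_trans wh.
(* The ramp [r] below is zero where [w <= m1] and one where [w >= m2]. *)
have [m1 [m2 [lo1 m12 h2]]] := between_two lohi.
have d0 : 0 < m2 - m1 by rewrite subr_gt0.
pose r := vjoin 0 (vmeet u ((m2 - m1)^-1 *: (w - m1 *: u))).
have um : uideal u (w - m1 *: u) by apply: uidealB => //; exact: uidealZ.
have umm : uideal u (vmeet u ((m2 - m1)^-1 *: (w - m1 *: u))).
  by apply: uideal_vmeet => //; exact: uidealZ.
have ur : uideal u r by apply: uideal_vjoin => //; exact: uideal0.
have rE phi : uspec u phi ->
    phi r = Num.max 0 (Num.min 1 ((m2 - m1)^-1 * (phi w - m1))).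
  move=> phiP; have um1 := uidealZ m1 uu.
  rewrite (ev_join phiP) ?(ev0 phiP)//; last exact: uideal0.
  rewrite (ev_meet phiP)//; last exact: uidealZ.
  by rewrite (ev_unit phiP) (evZ phiP)// (evB phiP)// (evZ phiP)// (ev_unit phiP) mulr1.
have r01 phi : uspec u phi -> 0 <= phi r <= 1.
  by move=> phiP; rewrite rE// le_max lexx /= ge_max ler01 /= ge_min lexx.
have [a ua aE] := ev_mul archE compE u0 (ux i) ur.
have xi0 phi : uspec u phi -> 0 <= phi (x i) by move=> phiP; exact: (ev_ge0 phiP).
pose b := x i - a.
have ub : uideal u b by exact: uidealB.
have bE phi : uspec u phi -> phi b = phi (x i) * (1 - phi r).
  by move=> phiP; rewrite (evB phiP)// aE// mulrBr mulr1.
have a0 : 0 <= a.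
  apply: (ev_ge0P archE u0) => // phi phiP; rewrite aE// mulr_ge0 ?xi0//.
  by have /andP[] := r01 _ phiP.
have b0 : 0 <= b.
  apply: (ev_ge0P archE u0) => // phi phiP; rewrite bE// mulr_ge0 ?xi0//.
  by have /andP[_] := r01 _ phiP; rewrite subr_ge0.
have -> : T x = T (dfwith x i a) + T (dfwith x i b).
  by rewrite -mlinD// addrC subrK dfwith_id.
move: i0s j0s; rewrite !in_cons !negb_or => /andP[i0i i0s] /andP[j0i j0s].
have keep (c : E) k : k != i -> dfwith x i c k = x k.
  by move=> ki; rewrite dfwithout// eq_sym.
have pos (c : E) : 0 <= c -> forall k, 0 <= dfwith x i c k.
  move=> c0 k; have [->|ki] := eqVneq k i; first by rewrite dfwithin.
  by rewrite keep.
have mem (c : E) : uideal u c -> forall k, uideal u (dfwith x i c k).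
  move=> uc k; have [->|ki] := eqVneq k i; first by rewrite dfwithin.
  by rewrite keep.
have outs k : k \notin s -> k != i -> k \notin i :: s.
  by move=> ks ki; rewrite in_cons negb_or ki.
rewrite (IH _ (fun k => (k == i) || side k) lo m1) ?(IH _ (fun k => (k != i) && side k) m2 hi) ?addr0//.
- exact: pos.
- exact: mem.
- move=> k ks /andP[ki sk] phi phiP ph; rewrite keep//.
  by apply: (left k) => //; exact: outs.
- move=> k ks; have [->|ki] := eqVneq k i => /= sk phi phiP ph.
    rewrite dfwithin bE// rE// (_ : Num.max _ _ = 1) ?subrr ?mulr0//.
    rewrite min_l ?max_r//.
    by rewrite mulrC ler_pdivlMr// mul1r lerB// ltW.
  rewrite keep//; apply: (right k) => //; first exact: outs.
  by apply: lt_trans ph; exact: lt_trans m12.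
- by rewrite i0i.
- by rewrite negb_and sj0 orbT.
- exact: pos.
- exact: mem.
- move=> k ks; have [->|ki] := eqVneq k i => /= sk phi phiP ph.
    rewrite dfwithin aE// rE// max_l ?mulr0//.
    rewrite ge_min; apply/orP; right.
    by rewrite pmulr_rle0 ?invr_gt0// subr_le0 ltW.
  rewrite keep//; apply: (left k) => //; first exact: outs.
  by apply: lt_trans ph _; exact: lt_trans h2.
- move=> k ks; rewrite negb_or => /andP[ki sk] phi phiP ph; rewrite keep//.
  by apply: (right k) => //; exact: outs.
- by rewrite si0 orbT.
- by rewrite negb_or j0i.
Qed.

(** Replacing [x i] by the positive part [p] of [x i - e *: u] opens a gap: [p] lives
    where [x i > e], while [x j] lives where [x i] is zero. The error made is of size
    [e], so [T x] is absorbed by a bounded set. *)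
Lemma mlin_disjoint_eq0 x i j : (forall k, 0 <= x k) -> vdisjoint (x i) (x j) ->
  T x = 0.
Proof.
move=> x0 xij.
pose u := \sum_k x k; have u0 : 0 <= u by exact: vsum_ge0.
have uu := uideal_unit u0.
have ux k : uideal u (x k) by exact: uideal_sum_ge0.
have [eij|ij] := eqVneq i j.
  apply: (mlin_eq0 Tlin (i := i)); apply: (ev_inj archE u0) => // [|phi phiP].
    exact: uideal0.
  rewrite (ev0 phiP); rewrite -eij in xij.
  by have [] := disjoint_ev (ux i) (ux i) phiP xij.
have n0 : (0 < n)%N by exact: leq_ltn_trans (ltn_ord i).
apply: (born_absorbed_eq0 (mlin_bounded n0 PT Pb u0)) => N.
set e := N.+1%:R^-1.
have e0 : 0 < e by rewrite invr_gt0 ltr0n.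
pose p := vjoin (x i - e *: u) 0.
have ue := uidealZ e uu.
have uxe : uideal u (x i - e *: u) by exact: uidealB.
have up : uideal u p by apply: uideal_vjoin => //; exact: uideal0.
have pE phi : uspec u phi -> phi p = Num.max (phi (x i) - e) 0.
  move=> phiP; rewrite (ev_join phiP) ?(ev0 phiP)//; last exact: uideal0.
  by rewrite (evB phiP)// (evZ phiP)// (ev_unit phiP) mulr1.
have Tp : T (dfwith x i p) = 0.
  apply: (@mlin_separated_eq0 u (x i) [seq k <- enum 'I_n | (k != i) && (k != j)]
    _ (pred1 i) 0 e i j) => //.
  - move=> k; have [<-|ik] := eqVneq i k; last by rewrite dfwithout.
    by rewrite dfwithin; exact: vjoinr.
  - move=> k; have [<-|ik] := eqVneq i k; last by rewrite dfwithout.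
    by rewrite dfwithin.
  - move=> k _ /eqP -> phi phiP ph; rewrite dfwithin pE// max_r// subr_le0 ltW//.
  - move=> k; rewrite mem_filter mem_enum andbT negb_and !negbK /= => + ki.
    rewrite (negbTE ki) /= => /eqP -> phi phiP ph; rewrite dfwithout//.
    by have [xi|] := disjoint_ev (ux i) (ux j) phiP xij; first rewrite xi ltxx in ph.
  - by rewrite mem_filter eqxx.
  - by rewrite mem_filter eqxx andbF.
  - exact: eqxx.
  - by rewrite /= eq_sym.
pose q := x i - p; have uq : uideal u q by exact: uidealB.
exists (T (dfwith x i (e^-1 *: q))).
  exists (dfwith x i (e^-1 *: q)) => // k.
  have [<-|ik] := eqVneq i k; last by rewrite dfwithout// vabs_pos// vle_sum.
  rewrite dfwithin -[leRHS]scale1r; apply/(ev_normP archE u0); first exact: uidealZ.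
  move=> phi phiP; rewrite (evZ phiP)// (evB phiP)// pE//.
  have phi0 : 0 <= phi (x i) by exact: (ev_ge0 phiP).
  rewrite normrM gtr0_norm ?invr_gt0// mulrC ler_pdivrMr// mul1r.
  exact: threshold_dist (ltW e0).
rewrite -mlinZ// scalerA mulfV ?gt_eqF// scale1r.
by rewrite mlinB// dfwith_id Tp subr0.
Qed.

Lemma additive_orthosymmetric : orthosymmetric T.
Proof. exact/(positive_orthosymmetric Tlin)/mlin_disjoint_eq0. Qed.

End positive_additivity.

(** * Complexification *)

Section cembed.
Context {R : realType} {V : lmodType R}.
Implicit Types (a : R) (c : R[i]).

Lemma cembed0 : cembed (0 : V) = 0. Proof. by []. Qed.

Lemma cembedD (x y : V) : cembed (x + y) = cembed x + cembed y.
Proof. by rewrite /cembed; congr pair; rewrite addr0. Qed.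

Lemma cembed_sum (I : Type) (r : seq I) (F : I -> V) :
  cembed (\sum_(i <- r) F i) = \sum_(i <- r) cembed (F i).
Proof. exact: (big_morph _ cembedD cembed0). Qed.

Lemma cscale_cembed c (x : V) :
  c *: cembed x = (complex.Re c *: x, complex.Im c *: x) :> complexification V.
Proof.
by rewrite /GRing.scale /= /cplx_scale /= !scaler0 subr0 add0r.
Qed.

Lemma cembedZ a (x : V) : cembed (a *: x) = (real_complex R a) *: cembed x.
Proof. by rewrite cscale_cembed /= scale0r. Qed.

End cembed.

Section cextend.
Context {R : realType} {V W : lmodType R} {n : nat}.
Variable (T : ('I_n -> V) -> W).
Hypothesis (Tlin : multilinear T).

(** [cextend T] is the complex multilinear extension of [T]: it may be expanded when
    its arguments are complex combinations of real vectors. *)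
Lemma cextend_expand (I : finType) (k0 : I) (v : 'I_n -> I -> V)
    (c : 'I_n -> I -> R[i]) (w : 'I_n -> complexification V) :
  (forall j, (w j).1 = \sum_k complex.Re (c j k) *: v j k) ->
  (forall j, (w j).2 = \sum_k complex.Im (c j k) *: v j k) ->
  cextend T w = \sum_(phi : {ffun 'I_n -> I})
    (\prod_j c j (phi j)) *: cembed (T (fun j => v j (phi j))).
Proof.
move=> w1 w2.
pose a (e : {ffun 'I_n -> bool}) j k :=
  if e j then complex.Im (c j k) else complex.Re (c j k).
have TE (e : {ffun 'I_n -> bool}) : T (fun j => if e j then (w j).2 else (w j).1) =
    \sum_(phi : {ffun 'I_n -> I}) (\prod_j a e j (phi j)) *: T (fun j => v j (phi j)).
  have -> : (fun j => if e j then (w j).2 else (w j).1) =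
      fun j => \sum_k a e j k *: v j k.
    by apply/funext => j; rewrite /a; case: (e j).
  rewrite (mlin_expand Tlin k0); apply: eq_bigr => phi _.
  exact: (mlin_scale Tlin (fun j => a e j (phi j))).
pose i : R[i] := Complex 0 1.
transitivity (\sum_(e : {ffun 'I_n -> bool}) \sum_(phi : {ffun 'I_n -> I})
  (i ^+ (\sum_j e j)%N * real_complex R (\prod_j a e j (phi j))) *:
    cembed (T (fun j => v j (phi j)))).
  apply: eq_bigr => e _; rewrite TE cembed_sum scaler_sumr.
  by apply: eq_bigr => phi _; rewrite cembedZ scalerA.
rewrite exchange_big /=; apply: eq_bigr => phi _.
rewrite -scaler_suml; congr (_ *: _).
transitivity (\sum_(e : {ffun 'I_n -> bool}) \prod_j
   (i ^+ (e j) * real_complex R (if e j then complex.Im (c j (phi j))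
                               else complex.Re (c j (phi j))))).
  by apply: eq_bigr => e _; rewrite expr_sum rmorph_prod /= -big_split.
rewrite -(bigA_distr_bigA (fun j (b : bool) => i ^+ b *
  real_complex R (if b then complex.Im (c j (phi j)) else complex.Re (c j (phi j))))).
by apply: eq_bigr => j _; rewrite big_bool /= expr1 expr0 mul1r addrC -complexE.
Qed.

End cextend.

Lemma prod_powers (C : comPzRingType) (V : nmodType) n (s : seq (V * nat)) (F : V -> C) :
  (\sum_(p <- s) p.2)%N = n ->
  \prod_(j < n) F (powers s j) = \prod_(p <- s) F p.1 ^+ p.2.
Proof.
move=> sn; pose t := flatten [seq nseq p.2 p.1 | p <- s].
have st : size t = n.
  rewrite /t size_flatten /shape -map_comp sumnE big_map -sn.
  by apply: eq_bigr => p _; rewrite /= size_nseq.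
transitivity (\prod_(x <- t) F x).
  by rewrite (big_nth 0) st big_mkord.
rewrite /t big_flatten big_map; apply: eq_bigr => p _.
by rewrite big_nseq iter_mulr_1.
Qed.

(** The supremum that defines the modulus is attained in the real case, at the
    argument of [a + i b]. *)
Lemma polar (R : realType) (a b : R) : exists2 t : R, t \in `[0, 2 * pi] &
  cos t * a + sin t * b = Num.sqrt (a ^+ 2 + b ^+ 2).
Proof.
set r := Num.sqrt _.
have r2 : r ^+ 2 = a ^+ 2 + b ^+ 2 by rewrite sqr_sqrtr// addr_ge0// sqr_ge0.
have [r0|r0] := eqVneq r 0.
  exists 0; first by rewrite in_itv /= lexx mulr_ge0// pi_ge0.
  have : a ^+ 2 + b ^+ 2 == 0 by rewrite -r2 r0 expr0n.
  rewrite paddr_eq0 ?sqr_ge0// !sqrf_eq0 => /andP[/eqP -> /eqP ->].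
  by rewrite !mulr0 addr0 r0.
have rpos : 0 < r by rewrite lt_def r0 sqrtr_ge0.
have ar : -1 <= a / r <= 1.
  rewrite -ler_norml normrM normfV (gtr0_norm rpos) ler_pdivrMr// mul1r.
  rewrite -(@ler_pXn2r _ 2) ?nnegrE ?(ltW rpos)//.
  by rewrite real_normK ?num_real// r2 lerDl sqr_ge0.
have sin2 : r * Num.sqrt (1 - (a / r) ^+ 2) = `|b|.
  rewrite -sqrtr_sqr -[X in X * _ = _](gtr0_norm rpos) -sqrtr_sqr -sqrtrM ?sqr_ge0//.
  congr Num.sqrt; have -> : b ^+ 2 = r ^+ 2 - a ^+ 2 by rewrite r2 addrC addKr.
  by field.
have cosE : cos (acos (a / r)) = a / r by rewrite acosK// in_itv.
have aa : a / r * a = a ^+ 2 / r by rewrite mulrAC.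
have fin (x : R) : x * b * r = b ^+ 2 -> a / r * a + x * b = r.
  move=> xb; apply: (mulIf r0); rewrite mulrDl xb aa divfK// -r2 expr2; ring.
have [b0|b0] := leP 0 b.
  exists (acos (a / r)).
    rewrite in_itv /= acos_ge0//= (le_trans (acos_lepi ar))//.
    by rewrite mulr_natl mulr2n lerDl pi_ge0.
  rewrite cosE sin_acos//; apply: fin.
  by rewrite mulrC mulrA sin2 ger0_norm// expr2.
exists (2 * pi - acos (a / r)).
  rewrite in_itv /= subr_ge0 (le_trans (acos_lepi ar)) ?gerBl ?acos_ge0//.
  by rewrite mulr_natl mulr2n lerDl pi_ge0.
have -> : 2 * pi - acos (a / r) = - acos (a / r) + pi *+ 2 by rewrite mulr_natl addrC.
rewrite cosD2pi sinD2pi cosN sinN cosE sin_acos//; apply: fin.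
set t := Num.sqrt _ in sin2 *.
have -> : - t * b * r = - (r * t) * b by ring.
by rewrite sin2 ltr0_norm// opprK expr2.
Qed.

(** * Means and moduli *)

Section means_theory.
Context {R : realType}.
Implicit Types (x : R).

Lemma nroot_exp n x : (0 < n)%N -> 0 <= x -> nroot n (x ^+ n) = x.
Proof.
move=> n0 x0; rewrite /nroot; have [->|xn0] := eqVneq x 0.
  by rewrite expr0n gtn_eqF// sgr0 mul0r.
have xpos : 0 < x by rewrite lt_def xn0.
rewrite gtr0_sg ?exprn_gt0// mul1r ger0_norm ?exprn_ge0//.
by rewrite -powR_mulrn// -powRrM mulfV ?powRr1// pnatr_eq0 -lt0n.
Qed.

Lemma nrootK n x : (0 < n)%N -> 0 <= x -> nroot n x ^+ n = x /\ 0 <= nroot n x.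
Proof.
move=> n0 x0; have [y y0 <-] : exists2 y, 0 <= y & y ^+ n = x.
  exists (x `^ n%:R^-1); first exact: powR_ge0.
  by rewrite -powR_mulrn ?powR_ge0// -powRrM mulVf ?powRr1// pnatr_eq0 -lt0n.
by rewrite nroot_exp.
Qed.

Lemma nroot_scale n c x : (0 < n)%N -> 0 <= c -> 0 <= x ->
  nroot n (c ^+ n * x) = c * nroot n x.
Proof.
move=> n0 c0 x0; have [rx r0] := nrootK n0 x0.
by rewrite -{1}rx -exprMn nroot_exp// mulr_ge0.
Qed.

Lemma Smean_scale n r (c : R) (x : 'I_r -> R) : (0 < n)%N -> 0 < c ->
  (forall k, 0 <= x k) -> Smean n (fun k => c * x k) = c * Smean n x.
Proof.
move=> n0 c0 x0; rewrite -nroot_scale ?(ltW c0)//; last first.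
  by apply: sumr_ge0 => k _; exact: exprn_ge0.
by rewrite mulr_sumr; congr nroot; apply: eq_bigr => k _; rewrite exprMn.
Qed.

Lemma Gmean_scale n (c : R) (x : 'I_n -> R) : (0 < n)%N -> 0 < c ->
  Gmean (fun k => c * x k) = c * Gmean x.
Proof.
move=> n0 c0; rewrite -nroot_scale ?(ltW c0)//; last exact: prodr_ge0.
congr nroot; under eq_bigr => k _ do rewrite normrM (gtr0_norm c0).
by rewrite big_split /= prodr_const card_ord.
Qed.

Lemma nroot0 n : nroot n 0 = 0 :> R.
Proof. by rewrite /nroot sgr0 mul0r. Qed.

End means_theory.

Lemma cmod_eq (R : realType) (E : vlatticeType R) (f g m : E) :
  (forall t : R, t \in `[0, 2 * pi] -> cos t *: f + sin t *: g <= m) ->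
  (forall h, (forall t : R, t \in `[0, 2 * pi] -> cos t *: f + sin t *: g <= h) ->
    m <= h) ->
  cmod ((f, g) : complexification E) = m.
Proof.
move=> ub lub; rewrite /cmod /=; set A := [set _ | _ in _].
have mA : supremums A m.
  split; first by move=> _ [t tI <-]; exact: ub.
  by move=> h hA; apply: lub => t tI; apply: hA; exists t.
rewrite /supremum; case: ifPn => [/eqP A0|_]; last first.
  by apply: (@is_subset1_supremums _ _ A) => //; apply: (@xgetPex _ 0 (supremums A)); exists m.
exfalso; have : A (cos 0 *: f + sin 0 *: g).
  by exists 0 => //=; rewrite in_itv /= lexx mulr_ge0// pi_ge0.
by rewrite A0.
Qed.

(** The bound [h] is tested at the angles [0] and [pi / 2]; the sum of disjoint
    positive elements is their join. *)
Lemma cmod_disjoint (R : realType) (E : vlatticeType R) (f g : E) :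
  0 <= f -> 0 <= g -> vdisjoint f g ->
  cmod ((f, g) : complexification E) = f + g.
Proof.
move=> f0 g0 fg; apply: cmod_eq => [t _|h hub].
  by apply: vleD; rewrite -[leRHS]scale1r; apply: vleZr => //; rewrite ?cos_le1 ?sin_le1.
have fh : f <= h.
  have := hub 0; rewrite cos0 sin0 scale1r scale0r addr0; apply.
  by rewrite in_itv /= lexx mulr_ge0// pi_ge0.
have gh : g <= h.
  have := hub (pi / 2); rewrite cos_pihalf sin_pihalf scale1r scale0r add0r; apply.
  have := pi_ge0 R; rewrite in_itv /= => p0.
  by apply/andP; split; lra.
have -> : f + g = vjoin f g.
  move: fg; rewrite /vdisjoint !vabs_pos// vmeetN => /eqP; rewrite oppr_eq0 => /eqP fg.
  have := vjoinDr (- g) (- f) (f + g).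
  by rewrite [vjoin (- g) _]vjoinC fg add0r addKr addrCA addNr addr0.
by rewrite vjoinP fh.
Qed.

(** For orthosymmetric [T] both sides of the identities for the means and for the
    modulus are values of one linear function by [mlin_factor], so that they reduce
    to identities between real or complex numbers at each point of a spectrum. *)
Section orthosymmetric_identities.
Context {R : realType} {E : vlatticeType R} {Y : convexBornType R} {n : nat}.
Hypothesis (archE : archimedean E) (compE : uniformly_complete E).
Variables (P : E -> Y) (T : ('I_n -> E) -> Y).
Hypotheses (PT : homogeneous_polynomial P T) (Pb : bounded_map P).
Hypothesis (Torth : orthosymmetric T).
Hypothesis (n_gt0 : (0 < n)%N).

Let Tlin : multilinear T. Proof. by case: PT. Qed.
Let TP f : P f = T (fun=> f). Proof. by case: PT. Qed.
Let i0 : 'I_n := Ordinal n_gt0.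

Let factor u f h := mlin_factor archE compE PT Pb Torth (u := u) (f := f) i0 (h := h).

Let power_factor u f h : 0 <= u -> uideal u f -> uideal u h ->
  (forall phi, uspec u phi -> phi h = phi f ^+ n) ->
  P f = T (dfwith (fun=> u) i0 h).
Proof.
move=> u0 uf uh hE; rewrite TP; apply: factor => // phi phiP.
by rewrite hE// prodr_const card_ord.
Qed.

Lemma orthosymmetric_Smean r (f : 'I_r -> E) : (forall k, 0 <= f k) ->
  P (fcalc (@Smean R n r) f) = \sum_(k < r) P (f k).
Proof.
move=> f0; pose u := \sum_k f k.
have u0 : 0 <= u by exact: vsum_ge0.
have uf k : uideal u (f k) by exact: uideal_sum_ge0.
have /choice[h hP] : forall k, exists t, uideal u t /\
    forall phi, uspec u phi -> phi t = phi (f k) ^+ n.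
  move=> k; have [t ut tE] := ev_prod archE compE u0 (index_enum 'I_n) (fun=> uf k).
  by exists t; split => // phi phiP; rewrite tE// prodr_const card_ord.
have uh k : uideal u (h k) by have [] := hP k.
have hE k phi : uspec u phi -> phi (h k) = phi (f k) ^+ n by have [_] := hP k; apply.
pose q := \sum_k h k.
have uq : uideal u q by exact: uideal_sum.
have qE phi : uspec u phi -> phi q = \sum_k phi (f k) ^+ n.
  by move=> phiP; rewrite (ev_sum phiP)//; apply: eq_bigr => k _; rewrite hE.
have phif phi k : uspec u phi -> 0 <= phi (f k) by move=> phiP; exact: (ev_ge0 phiP).
have q0 : 0 <= q.
  apply: (ev_ge0P archE u0) => // phi phiP; rewrite qE//.
  by apply: sumr_ge0 => k _; apply: exprn_ge0; exact: phif.
have [g ug gE] := ev_root archE compE u0 n_gt0 uq q0.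
have -> : fcalc (@Smean R n r) f = g.
  apply: fcalc_ev => //.
  - by rewrite /Smean big1 ?nroot0// => k _; rewrite expr0n gtn_eqF.
  - by move=> c x c0 x0; exact: Smean_scale.
  - move=> phi phiP; have [g0 gn] := gE _ phiP.
    by rewrite /Smean -qE// -gn nroot_exp.
rewrite (power_factor u0 ug uq) => [|phi phiP]; last by have [_ ->] := gE _ phiP.
rewrite mlin_sum_at//; apply: eq_bigr => k _.
by rewrite (power_factor u0 (uf k) (uh k))// => phi phiP; rewrite hE.
Qed.

Lemma orthosymmetric_Gmean (f : 'I_n -> E) : (forall k, 0 <= f k) ->
  P (fcalc (@Gmean R n) f) = T f.
Proof.
move=> f0; pose u := \sum_k f k.
have u0 : 0 <= u by exact: vsum_ge0.
have uf k : uideal u (f k) by exact: uideal_sum_ge0.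
have [q uq qE] := ev_prod archE compE u0 (index_enum 'I_n) uf.
have phif phi k : uspec u phi -> 0 <= phi (f k) by move=> phiP; exact: (ev_ge0 phiP).
have q0 : 0 <= q.
  apply: (ev_ge0P archE u0) => // phi phiP; rewrite qE//.
  by apply: prodr_ge0 => k _; exact: phif.
have [g ug gE] := ev_root archE compE u0 n_gt0 uq q0.
have -> : fcalc (@Gmean R n) f = g.
  apply: fcalc_ev => //.
  - by rewrite /Gmean (bigD1 i0)//= normr0 mul0r nroot0.
  - by move=> c x c0 x0; exact: Gmean_scale.
  - move=> phi phiP; have [g0 gn] := gE _ phiP.
    rewrite /Gmean (eq_bigr (fun k => phi (f k))); last first.
      by move=> k _; rewrite ger0_norm//; exact: phif.
    by rewrite -qE// -gn nroot_exp.
rewrite (power_factor u0 ug uq) => [|phi phiP]; last by have [_ ->] := gE _ phiP.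
by rewrite (factor u0 uf uq).
Qed.

(** The modulus is the pointwise square root [m] of [f ^ 2 + g ^ 2]. A competing
    upper bound [h] may lie outside of the principal ideal of [u]; its meet with
    [m] lies inside and is still an upper bound. *)
Lemma cmod_ev (f g : E) : let u := vabs f + vabs g in
  uideal u (cmod ((f, g) : complexification E)) /\
  forall phi, uspec u phi ->
    phi (cmod ((f, g) : complexification E)) ^+ 2 = phi f ^+ 2 + phi g ^+ 2.
Proof.
move=> u; have u0 : 0 <= u by rewrite vaddr_ge0 ?vabs_ge0.
have uf : uideal u f by exists 1; rewrite scale1r vler_addr ?vabs_ge0.
have ug : uideal u g by exists 1; rewrite scale1r /u addrC vler_addr ?vabs_ge0.
have [f2 uf2 f2E] := ev_mul archE compE u0 uf uf.
have [g2 ug2 g2E] := ev_mul archE compE u0 ug ug.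
have uq : uideal u (f2 + g2) by exact: uidealD.
have qE phi : uspec u phi -> phi (f2 + g2) = phi f ^+ 2 + phi g ^+ 2.
  by move=> phiP; rewrite (evD phiP)// f2E// g2E// -!expr2.
have q0 : 0 <= f2 + g2.
  apply: (ev_ge0P archE u0) => // phi phiP; rewrite qE//.
  by rewrite addr_ge0// sqr_ge0.
have [m um mE] := ev_root archE compE u0 (ltn0Sn 1) uq q0.
have mm phi : uspec u phi -> phi m = Num.sqrt (phi f ^+ 2 + phi g ^+ 2).
  move=> phiP; have [m0 m2] := mE _ phiP.
  by rewrite -qE// -m2 sqrtr_sqr ger0_norm.
have uct (t : R) : uideal u (cos t *: f + sin t *: g).
  by apply: uidealD; exact: uidealZ.
have ctE (t : R) phi : uspec u phi ->
    phi (cos t *: f + sin t *: g) = cos t * phi f + sin t * phi g.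
  by move=> phiP; rewrite (evD phiP) ?(evZ phiP)//; exact: uidealZ.
have ub (t : R) : cos t *: f + sin t *: g <= m.
  apply: (ev_leP archE u0) => // phi phiP; rewrite ctE// mm//.
  set a := phi f; set b := phi g.
  apply: le_trans (ler_norm _) _; rewrite -sqrtr_sqr ler_wsqrtr//.
  have -> : a ^+ 2 + b ^+ 2 = (cos t * a + sin t * b) ^+ 2 + (sin t * a - cos t * b) ^+ 2.
    rewrite -[LHS]mul1r -(cos2Dsin2 t); ring.
  by rewrite lerDl sqr_ge0.
suff -> : cmod ((f, g) : complexification E) = m.
  by split => // phi phiP; have [_ ->] := mE _ phiP; exact: qE.
apply: cmod_eq => // h hub.
have fm : f <= vmeet h m.
  rewrite vmeetP; apply/andP; split.
    have := hub 0; rewrite cos0 sin0 scale1r scale0r addr0; apply.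
    by rewrite in_itv /= lexx mulr_ge0// pi_ge0.
  by have := ub 0; rewrite cos0 sin0 scale1r scale0r addr0.
have uh : uideal u (vmeet h m).
  apply: (@uideal_solid _ _ _ _ (vabs f + vabs m)).
    by apply: uidealD; exact: uideal_vabs.
  rewrite [leRHS]vabs_pos ?vaddr_ge0 ?vabs_ge0// vabs_le; apply/andP; split.
    by apply: le_trans (vmeetr _ _) _; rewrite [leRHS]addrC vler_addr ?vle_abs ?vabs_ge0.
  apply: (@le_trans _ _ (- f)); first by rewrite vleN2.
  by rewrite vler_addr ?vleN_abs ?vabs_ge0.
apply: le_trans (vmeetl h m); apply: (ev_leP archE u0) => // phi phiP.
have [t tI tE] := polar (phi f) (phi g).
rewrite mm// -tE -ctE//; apply: (ev_le phiP) => //.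
by rewrite vmeetP hub// ub.
Qed.

(** The complex counterpart of [mlin_factor]: the sum over the choices of real and
    imaginary parts is the expansion of the product of the complex numbers
    [phi (w j).1 + i phi (w j).2], of which the real and imaginary parts are
    compared separately. *)
Lemma cextend_factor (u g : E) (w : 'I_n -> complexification E) : 0 <= u ->
  uideal u g -> (forall j, uideal u (w j).1) -> (forall j, uideal u (w j).2) ->
  (forall phi, uspec u phi ->
    \prod_j (Complex (phi (w j).1) (phi (w j).2)) = real_complex R (phi g ^+ n)) ->
  cextend T w = cembed (P g).
Proof.
move=> u0 ug w1 w2 wE; have uu := uideal_unit u0.
pose i : R[i] := Complex 0 1.
pose v (j : 'I_n) (b : bool) := if b then (w j).2 else (w j).1.
have uv j b : uideal u (v j b) by rewrite /v; case: b.
have [h uh hE] := ev_prod archE compE u0 (index_enum 'I_n) (fun=> ug).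
have /choice[H HP] : forall e : {ffun 'I_n -> bool}, exists t, uideal u t /\
    forall phi, uspec u phi -> phi t = \prod_j phi (v j (e j)).
  move=> e; have [t ut tE] :=
    ev_prod archE compE u0 (index_enum 'I_n) (fun j => uv j (e j)).
  by exists t.
have uH e : uideal u (H e) by have [] := HP e.
have HE e phi : uspec u phi -> phi (H e) = \prod_j phi (v j (e j)).
  by have [_] := HP e; apply.
have wprod phi : uspec u phi -> \sum_(e : {ffun 'I_n -> bool})
    (\prod_j (i ^+ (e j))) * real_complex R (phi (H e)) = real_complex R (phi h).
  move=> phiP; rewrite hE// prodr_const card_ord -wE//.
  rewrite (eq_bigr (fun e : {ffun 'I_n -> bool} =>
      \prod_j (i ^+ e j * real_complex R (phi (v j (e j)))))); last first.
    by move=> e _; rewrite HE// rmorph_prod /= -big_split.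
  rewrite -(bigA_distr_bigA (fun j (b : bool) => i ^+ b * real_complex R (phi (v j b)))).
  apply: eq_bigr => j _; rewrite big_bool /= expr1 expr0 mul1r addrC.
  by rewrite [RHS]complexE.
pose L x := T (dfwith (fun=> u) i0 x).
have TH (e : {ffun 'I_n -> bool}) : T (fun j => v j (e j)) = L (H e).
  by rewrite /L (factor u0 (fun j => uv j (e j)) (uH e))// => phi /HE.
have Lsum (a : {ffun 'I_n -> bool} -> R) :
    \sum_e a e *: L (H e) = L (\sum_e a e *: H e).
  by rewrite /L mlin_sum_at//; apply: eq_bigr => e _; rewrite mlinZ.
have Pg : P g = L h.
  by apply: power_factor => // phi phiP; rewrite hE// prodr_const card_ord.
rewrite (cextend_expand Tlin false (v := v) (c := fun _ b => i ^+ b)); last 2 first.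
- by move=> j; rewrite big_bool /= scale0r scale1r add0r.
- by move=> j; rewrite big_bool /= scale0r scale1r addr0.
rewrite (eq_bigr (fun e : {ffun 'I_n -> bool} =>
   (complex.Re (\prod_j i ^+ e j) *: L (H e), complex.Im (\prod_j i ^+ e j) *: L (H e))
     : complexification Y)); last first.
  by move=> e _; rewrite TH cscale_cembed.
have pair_sum (F : {ffun 'I_n -> bool} -> complexification Y) :
    \sum_e F e = (\sum_e (F e).1, \sum_e (F e).2).
  by elim/big_rec3 : _ => [//|e a b c _ ->].
rewrite pair_sum /= !Lsum Pg /cembed; congr pair.
  congr L; apply: (ev_inj archE u0) => // [|phi phiP].
    by apply: uideal_sum => e _; exact: uidealZ.
  rewrite (ev_sum phiP) => [|e]; last exact: uidealZ.
  have := congr1 (@complex.Re R) (wprod _ phiP).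
  rewrite raddf_sum /= => <-; apply: eq_bigr => e _.
  by rewrite (evZ phiP)//; case: (\prod_j _) => a b /=; rewrite mulr0 subr0.
rewrite (_ : \sum_e _ = 0) /L ?mlin0//.
apply: (ev_inj archE u0) => // [||phi phiP].
- by apply: uideal_sum => e _; exact: uidealZ.
- exact: uideal0.
rewrite (ev_sum phiP) => [|e]; last exact: uidealZ.
rewrite (ev0 phiP); have := congr1 (@complex.Im R) (wprod _ phiP).
rewrite raddf_sum /= => im0; rewrite -[RHS]im0; apply: eq_bigr => e _.
by rewrite (evZ phiP)//; case: (\prod_j _) => a b /=; rewrite mulr0 add0r.
Qed.

End orthosymmetric_identities.

(** * From the identities to additivity *)

Section powers_theory.
Context {R : realType} {V W : lmodType R} {n : nat}.
Variables (P : V -> W) (T : ('I_n -> V) -> W).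
Hypothesis (PT : homogeneous_polynomial P T).
Implicit Types (e : {ffun 'I_n -> bool}) (f g : V).

Let Tlin : multilinear T. Proof. by case: PT. Qed.
Let Tsym : symmetric_map T. Proof. by case: PT. Qed.
Let TP f : P f = T (fun=> f). Proof. by case: PT. Qed.

Lemma mlin_powers e f g : let k := (\sum_j e j)%N in
  T (fun j => if e j then g else f) = T (powers [:: (f, (n - k)%N); (g, k)]).
Proof.
move=> k; apply: (mlin_perm_eq Tsym); set F := fun j => _.
have kE : k = count e (enum 'I_n).
  by rewrite /k -sum1_count -big_enum [RHS]big_mkcond; apply: eq_bigr => j _; case: (e j).
have Fe (s : seq 'I_n) : [seq F j | j <- s & e j] = nseq (count e s) g.
  by elim: s => //= j s IH; case ej : (e j); rewrite //= IH /F ej.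
have Fne (s : seq 'I_n) : [seq F j | j <- s & predC e j] = nseq (count (predC e) s) f.
  by elim: s => //= j s IH; case ej : (e j); rewrite //= IH /F ej.
have kn : count (predC e) (enum 'I_n) = (n - k)%N.
  by have := count_predC e (enum 'I_n); rewrite size_enum_ord kE; lia.
have -> : [seq powers [:: (f, (n - k)%N); (g, k)] j | j <- enum 'I_n] =
    [seq F j | j <- [seq j <- enum 'I_n | predC e j] ++ [seq j <- enum 'I_n | e j]].
  rewrite map_cat Fe Fne kn -kE.
  have st : size (nseq (n - k) f ++ nseq k g) = n.
    by rewrite size_cat !size_nseq subnK// kE -[leqRHS]size_enum_ord count_size.
  rewrite (map_comp (nth 0 _) val) val_enum_ord /= cats0 -[in iota _ _]st.
  exact: mkseq_nth.
by apply: perm_map; rewrite perm_sym perm_catC perm_filterC.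
Qed.

(** The binomial expansion of [P (f + g)] without its mixed terms. *)
Lemma additive_at f g : (0 < n)%N ->
  (forall k, (1 <= k <= n.-1)%N -> T (powers [:: (f, (n - k)%N); (g, k)]) = 0) ->
  P (f + g) = P f + P g.
Proof.
move=> n0 mixed; pose c b : {ffun 'I_n -> bool} := [ffun=> b].
have ctrue : c true != c false.
  by apply/eqP => /ffunP/(_ (Ordinal n0)); rewrite !ffunE.
rewrite TP (mlin_expand_bool Tlin (fun=> f) (fun=> g)).
rewrite (bigD1 (c false))//= (bigD1 (c true))//= big1 ?addr0.
  by rewrite !TP; congr +%R; congr T; apply/funext => j; rewrite ffunE.
move=> e /andP[ef et]; rewrite mlin_powers mixed//.
apply/andP; split.
  rewrite lt0n sum_nat_eq0; apply: contra ef => /forallP e0.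
  by apply/eqP/ffunP => j; have := e0 j; rewrite ffunE /= eqb0 => /negbTE.
rewrite -ltnS prednK//; have le : (\sum_j e j <= \sum_(j < n) 1)%N.
  by apply: leq_sum => j _; exact: leq_b1.
rewrite [X in (_ <= X)%N]sum_nat_const card_ord muln1 in le.
rewrite ltn_neqAle le andbT; apply: contra et => /eqP sn.
have [j /negbTE ej|all1] := pickP (fun j => ~~ e j); last first.
  by apply/eqP/ffunP => j; rewrite ffunE; have /negbFE := all1 j.
exfalso; move: sn; rewrite (bigD1 j)//= ej add0n => sn.
have : (\sum_(i < n | i != j) e i <= \sum_(i < n | i != j) 1)%N.
  by apply: leq_sum => i _; exact: leq_b1.
by rewrite sn sum1_card cardC1 card_ord; case: (n) n0 => // m _; rewrite ltnn.
Qed.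

End powers_theory.

(** Passing from [p (s)] to [p (2 s) - 2 ^ N p (s)] removes the top coefficient and
    multiplies the others by nonzero factors. *)
Lemma poly_coef_eq0 (R : realType) (W : lmodType R) (N : nat) (v : nat -> W) :
  (forall s : R, 0 <= s -> \sum_(k < N) s ^+ k *: v k = 0) ->
  forall k, (k < N)%N -> v k = 0.
Proof.
elim: N v => // N IH v v0.
have low k : (k < N)%N -> v k = 0.
  move=> kN; have ne : (2 ^+ k - 2 ^+ N : R) != 0.
    by rewrite subr_eq0 -!natrX eqr_nat eqn_exp2l// ltn_eqF.
  apply/(scalerI ne); rewrite scaler0.
  apply: (IH (fun k => (2 ^+ k - 2 ^+ N) *: v k)) => // s s0.
  transitivity ((\sum_(i < N) (2 * s) ^+ i *: v i + (2 * s) ^+ N *: v N) -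
      2 ^+ N *: (\sum_(i < N) s ^+ i *: v i + s ^+ N *: v N)).
    rewrite scalerDr scalerA -exprMn opprD addrACA subrr addr0 scaler_sumr -sumrB.
    apply: eq_bigr => i _; rewrite !scalerA -scalerBl exprMn.
    by congr (_ *: _); ring.
  have := v0 (2 * s) (mulr_ge0 (ler0n _ 2) s0); have := v0 s s0.
  by rewrite !big_ord_recr /= => -> ->; rewrite scaler0 subr0.
move=> k; rewrite ltnS leq_eqVlt => /predU1P[->|]; last exact: low.
have := v0 1 ler01; rewrite big_ord_recr /= expr1n scale1r big1 ?add0r//.
by move=> i _; rewrite low// scaler0.
Qed.

(** How the modulus identity yields additivity. For disjoint positive [f] and [g],
    and [s >= 0], the modulus of [f + i s g] is [f + s g]. Both sides of the identity
    are then polynomials in [s]. On the left the coefficient of degree [k] is the sum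
    over all subsets [e] of size [k] of the mixed term
    [t k = T (f ^ (n - k), g ^ k)]; on the right each subset is weighted by the
    unimodular number [D d e], the product of the numbers [d j] over [e], where
    [d] takes both values [i] and [- i]. So [t k] is killed by the sum of the defects
    [1 - complex.Re (D d e)], which is positive for [0 < k < n] because the product
    is not constant on subsets of size [k]. *)
Section modulus_identity.
Context {R : realType} {V W : lmodType R} {n : nat}.
Variables (P : V -> W) (T : ('I_n -> V) -> W).
Hypothesis (PT : homogeneous_polynomial P T).
Implicit Types (e : {ffun 'I_n -> bool}) (f g : V) (d : 'I_n -> R[i]).

Let Tlin : multilinear T. Proof. by case: PT. Qed.
Let TP f : P f = T (fun=> f). Proof. by case: PT. Qed.

Let wgt e := (\sum_j e j)%N.
Let D d e := \prod_j (if e j then d j else 1).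

Lemma subset_separating (p q : 'I_n) k : p != q -> (1 <= k <= n.-1)%N ->
  exists e, [/\ e p, ~~ e q & wgt e = k].
Proof.
move=> pq /andP[k0 kn].
pose r := p :: rem p (enum 'I_n).
have er : perm_eq (enum 'I_n) r by apply: perm_to_rem; rewrite mem_enum.
have ur : uniq r by rewrite -(perm_uniq er) enum_uniq.
have sr : size r = n by rewrite -(perm_size er) size_enum_ord.
pose t := take k (rem q r).
have ut : uniq t by rewrite take_uniq// rem_uniq.
have st : size t = k.
  rewrite size_takel// size_rem ?sr//.
  by rewrite -(perm_mem er) mem_enum.
exists [ffun j => j \in t]; rewrite !ffunE; split.
- by rewrite /t /r /= (negbTE pq); case: k k0 kn {t ut st} => // k _ _; rewrite /= mem_head.
- apply/negP => /mem_take; rewrite mem_rem_uniq// inE eqxx //.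
- rewrite /wgt -st -(card_uniqP ut) -sum1_card [RHS]big_mkcond.
  by apply: eq_bigr => j _; rewrite ffunE; case: (j \in t).
Qed.

Lemma Re_unimodular_le1 (c : R[i]) : `|c| = 1 -> complex.Re c <= 1.
Proof.
move=> c1; have := normc_ge_Re c; rewrite c1 -[1]/(real_complex R 1) lecR.
by apply: le_trans; exact: ler_norm.
Qed.

(** Exchanging [p] and [q] in a subset that contains just one of them reverses
    the sign of the product, so the defects of the two subsets add up to two. *)
Lemma sum_defect_neq0 d (p q : 'I_n) k : (forall j, `|d j| = 1) -> p != q ->
  d p = Complex 0 1 -> d q = - Complex 0 1 -> (1 <= k <= n.-1)%N ->
  \sum_(e : {ffun 'I_n -> bool} | wgt e == k) (1 - complex.Re (D d e)) != 0.
Proof.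
move=> d1 pq dp dq kn.
have D1 e : `|D d e| = 1.
  by rewrite normr_prod big1// => j _; case: (e j); rewrite ?normr1.
have [e [ep eq ek]] := subset_separating pq kn.
pose e' : {ffun 'I_n -> bool} :=
  [ffun j => if j == p then false else if j == q then true else e j].
have qp : q != p by rewrite eq_sym.
have rest j : (j != p) && (j != q) -> e' j = e j.
  by move=> /andP[/negbTE jp /negbTE jq]; rewrite ffunE jp jq.
have e'p : e' p = false by rewrite ffunE eqxx.
have e'q : e' q = true by rewrite ffunE (negbTE qp) eqxx.
have e'k : wgt e' = k.
  rewrite -ek /wgt (bigD1 p)//= (bigD1 q)//= [RHS](bigD1 p)//= [X in _ = (_ + X)%N](bigD1 q)//=.
  rewrite e'p e'q ep (negbTE eq) !add0n; congr (_ + _)%N.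
  by apply: eq_bigr => j /rest ->.
apply/negP => /eqP sum0.
have ge0 e1 : wgt e1 == k -> 0 <= 1 - complex.Re (D d e1).
  by move=> _; rewrite subr_ge0 Re_unimodular_le1.
have term e1 : wgt e1 = k -> complex.Re (D d e1) = 1.
  move=> /eqP e1k; have /eqP := psumr_eq0P ge0 sum0 e1k.
  by rewrite subr_eq0 => /eqP.
have opp : D d e' = - D d e.
  rewrite /D (bigD1 p)//= (bigD1 q)//= [in RHS](bigD1 p)//= [X in _ = - (_ * X)](bigD1 q)//=.
  rewrite e'p e'q ep (negbTE eq) dp dq !mul1r mulNr; congr (- (_ * _)).
  by apply: eq_bigr => j /rest ->.
have := term e' e'k; rewrite opp raddfN /= term// => /eqP.
by rewrite -subr_eq0 -opprD oppr_eq0 -[1 + 1]/(2%:R) pnatr_eq0.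
Qed.

Lemma modulus_mixed_eq0 d (p q : 'I_n) f g : (forall j, `|d j| = 1) -> p != q ->
  d p = Complex 0 1 -> d q = - Complex 0 1 ->
  (forall s : R, 0 <= s -> cembed (P (f + s *: g)) =
     cextend T (fun j => (f + (s * complex.Re (d j)) *: g, (s * complex.Im (d j)) *: g))) ->
  forall k, (1 <= k <= n.-1)%N -> T (powers [:: (f, (n - k)%N); (g, k)]) = 0.
Proof.
move=> d1 pq dp dq Hmod k kn.
pose t k := T (powers [:: (f, (n - k)%N); (g, k)]).
pose A k := \sum_(e : {ffun 'I_n -> bool} | wgt e == k) (1 - complex.Re (D d e)).
have Te e : T (fun j => if e j then g else f) = t (wgt e).
  exact: (mlin_powers PT).
have prod_s (s : R) e : \prod_j (if e j then s else 1) = s ^+ wgt e.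
  by rewrite /wgt expr_sum; apply: eq_bigr => j _; case: (e j).
have Psum (s : R) : P (f + s *: g) = \sum_(e : {ffun 'I_n -> bool}) s ^+ wgt e *: t (wgt e).
  rewrite TP (mlin_expand_bool Tlin (fun=> f) (fun=> s *: g)).
  apply: eq_bigr => e _; rewrite -Te -prod_s -(mlin_scale Tlin).
  by congr T; apply/funext => j; case: (e j); rewrite ?scale1r.
have Csum (s : R) : 0 <= s -> P (f + s *: g) =
    \sum_(e : {ffun 'I_n -> bool}) (s ^+ wgt e * complex.Re (D d e)) *: t (wgt e).
  move=> s0; have := congr1 fst (Hmod s s0); rewrite /= => ->.
  rewrite (cextend_expand Tlin false (v := fun _ b => if b then g else f)
     (c := fun j (b : bool) => if b then real_complex R s * d j else 1)); last 2 first.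
  - move=> j; rewrite big_bool /= scale1r addrC; congr (_ + _ *: _).
    by case: (d j) => a b /=; rewrite mul0r subr0.
  - move=> j; rewrite big_bool /= scale0r addr0; congr (_ *: _).
    by case: (d j) => a b /=; rewrite mul0r addr0.
  rewrite (big_morph (fun z : complexification W => z.1) (id1 := 0) (op1 := +%R))//.
  apply: eq_bigr => e _; rewrite Te cscale_cembed /=; congr (_ *: _).
  have -> : \prod_j (if e j then real_complex R s * d j else 1) =
      real_complex R (s ^+ wgt e) * D d e.
    rewrite -prod_s rmorph_prod /D -big_split; apply: eq_bigr => j _ /=.
    by case: (e j); rewrite ?rmorph1 ?mul1r.
  by case: (D d e) => a b /=; rewrite mul0r subr0.
have wn e : (wgt e < n.+1)%N.
  rewrite ltnS -[leqRHS]card_ord -sum1_card; apply: leq_sum => j _; exact: leq_b1.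
have At : A k *: t k = 0.
  have kn1 : (k < n.+1)%N by case/andP: kn => _ kn; apply: leq_trans kn _; exact: leq_pred.
  apply: (@poly_coef_eq0 _ _ n.+1 (fun k => A k *: t k)) kn1 => s s0.
  have /eqP := Csum s s0; rewrite {1}Psum -subr_eq0 -sumrB => /eqP sum0.
  rewrite -[RHS]sum0 [RHS](partition_big (fun e => Ordinal (wn e)) xpredT)//=.
  apply: eq_bigr => i _; rewrite scalerA /A mulr_sumr scaler_suml.
  apply: eq_big => [e|e /eqP ei]; first by [].
  by rewrite -scalerBl ei mulrBr mulr1.
by apply/(scalerI (sum_defect_neq0 d1 pq dp dq kn)); rewrite scaler0.
Qed.

End modulus_identity.

Section converses.
Context {R : realType} {E : vlatticeType R} {Y : convexBornType R} {n : nat}.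
Hypothesis (archE : archimedean E).
Variables (P : E -> Y) (T : ('I_n -> E) -> Y).
Hypotheses (PT : homogeneous_polynomial P T).
Hypothesis (n_gt1 : (1 < n)%N).

Let Tlin : multilinear T. Proof. by case: PT. Qed.
Let TP f : P f = T (fun=> f). Proof. by case: PT. Qed.

Lemma polynomial0 : P 0 = 0.
Proof. by rewrite TP; apply: (mlin_eq0 Tlin (i := Ordinal (ltnW n_gt1))). Qed.

Lemma vdisjointZr (f g : E) (s : R) : 0 <= f -> 0 <= g -> vdisjoint f g ->
  vdisjoint f (s *: g).
Proof.
move=> f0 g0 fg; pose u := f + g; have u0 : 0 <= u by exact: vaddr_ge0.
have uf : uideal u f by apply: (@uideal_le _ _ _ _ 1) => //; rewrite scale1r vler_addr.
have ug : uideal u g.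
  by apply: (@uideal_le _ _ _ _ 1) => //; rewrite scale1r /u addrC vler_addr.
apply: (ev_disjoint archE u0) => // [|phi phiP]; first exact: uidealZ.
have [->|g1] := disjoint_ev uf ug phiP fg; first by left.
by right; rewrite (evZ phiP)// g1 mulr0.
Qed.

Lemma gen_hom_ge0 s (f : 'I_s -> E) g phi k : (forall k, 0 <= f k) ->
  vlattice_hom_on (smallest vector_sublattice (range f `|` [set g])) phi ->
  0 <= phi (f k) /\ phi 0 = 0.
Proof.
move=> f0 [lin join _]; have [L0 _ _ _] := gen_sublattice f g.
have phi0 : phi 0 = 0.
  by have := lin (-1) 0 0 L0 L0; rewrite scaler0 addr0 mulN1r addNr.
split=> //; have fk : smallest vector_sublattice (range f `|` [set g]) (f k) by exact: gen_f.
by rewrite -(vjoin_id (f0 k)) join// phi0 le_max lexx.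
Qed.

(** For disjoint positive [f] and [g] the mean of [f, g, 0, ..., 0] is [f + g]: a
    homomorphism is zero at one of the two. *)
Lemma Smean_additive r : (1 < r)%N ->
  (forall f : 'I_r -> E, (forall k, 0 <= f k) ->
     P (fcalc (@Smean R n r) f) = \sum_(k < r) P (f k)) ->
  positively_orthogonally_additive P.
Proof.
move=> r1 HS f g f0 g0 fg.
pose i0 : 'I_r := Ordinal (ltnW r1); pose i1 : 'I_r := Ordinal r1.
have i10 : i1 != i0 by [].
pose F (k : 'I_r) : E := if k == i0 then f else if k == i1 then g else 0.
have F0 k : 0 <= F k by rewrite /F; case: ifP => // _; case: ifP.
have Fi0 : F i0 = f by rewrite /F eqxx.
have Fi1 : F i1 = g by rewrite /F (negbTE i10) eqxx.
have Fk k : (k != i0) && (k != i1) -> F k = 0.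
  by move=> /andP[/negbTE k0 /negbTE k1]; rewrite /F k0 k1.
have := HS F F0; rewrite (bigD1 i0)//= (bigD1 i1)//= Fi0 Fi1 big1 ?addr0; last first.
  by move=> k /Fk ->; exact: polynomial0.
move=> <-; congr P; apply/esym/(fcalc_eq archE) => phi phiP.
have [phif phi0] := gen_hom_ge0 i0 F0 phiP.
have [phig _] := gen_hom_ge0 i1 F0 phiP.
rewrite Fi0 in phif; rewrite Fi1 in phig.
have [lin _ meet] := phiP.
have gf : smallest vector_sublattice (range F `|` [set f + g]) f.
  by rewrite -Fi0; exact: gen_f.
have gg : smallest vector_sublattice (range F `|` [set f + g]) g.
  by rewrite -Fi1; exact: gen_f.
have fgE : phi (f + g) = phi f + phi g.
  by rewrite -[f]scale1r lin// mul1r scale1r.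
have min0 : Num.min (phi f) (phi g) = 0.
  by rewrite -meet// -phi0; congr phi; move: fg; rewrite /vdisjoint !vabs_pos.
rewrite /Smean (bigD1 i0)//= (bigD1 i1)//= Fi0 Fi1 big1 ?addr0; last first.
  by move=> k /Fk ->; rewrite phi0 expr0n gtn_eqF// ltnW.
have n0 : (0 < n)%N by exact: ltnW.
rewrite fgE; move: min0; case: leP => _ ->.
  by rewrite expr0n gtn_eqF// !add0r nroot_exp.
by rewrite expr0n gtn_eqF// !addr0 nroot_exp.
Qed.

(** The geometric mean of a tuple with two disjoint entries is zero. *)
Lemma Gmean_orthosymmetric :
  (forall f : 'I_n -> E, (forall k, 0 <= f k) -> P (fcalc (@Gmean R n) f) = T f) ->
  orthosymmetric T.
Proof.
move=> HG; apply: positive_orthosymmetric => // f i j f0 fij.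
rewrite -HG// (_ : fcalc _ _ = 0) ?polynomial0//.
apply: (fcalc_eq archE) => phi phiP.
have [phii phi0] := gen_hom_ge0 i f0 phiP.
have [phij _] := gen_hom_ge0 j f0 phiP.
have [_ _ meet] := phiP.
have min0 : Num.min (phi (f i)) (phi (f j)) = 0.
  rewrite -meet; [|exact: gen_f|exact: gen_f].
  by rewrite -phi0; congr phi; move: fij; rewrite /vdisjoint !vabs_pos.
rewrite phi0 /Gmean; suff [k fk] : exists k, phi (f k) = 0.
  by rewrite (bigD1 k)//= fk normr0 mul0r nroot0.
by move: min0; case: leP => _ z; [exists i|exists j].
Qed.

Lemma modulus_additive :
  (~~ odd n -> forall z : complexification E,
     cembed (P (cmod z)) = cextend T (powers [:: (z, n./2); (cconj z, n./2)])) ->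
  (odd n -> forall z : complexification E,
     cembed (P (cmod z)) =
     cextend T (powers [:: (z, n.-1./2); (cconj z, n.-1./2); (cembed (cmod z), 1%N)])) ->
  positively_orthogonally_additive P.
Proof.
move=> even_case odd_case f g f0 g0 fg.
apply: (additive_at PT) => [|k kn]; first exact: ltnW.
pose m := n./2.
have nm : n = (odd n + m + m)%N by rewrite -addnA addnn odd_double_half.
have m0 : (0 < m)%N by rewrite half_gt0.
have mn : (m < n)%N by rewrite nm; lia.
pose i : R[i] := Complex 0 1.
(* The three values belong to [z], to its conjugate and, in the odd case, to the
   real argument in the last place. *)
pose d (j : 'I_n) := if (j < m)%N then i else if (j < m + m)%N then - i else 1.
pose p : 'I_n := Ordinal (ltnW n_gt1); pose q : 'I_n := Ordinal mn.
apply: (modulus_mixed_eq0 PT (d := d) (p := p) (q := q)) => //.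
- have i1 : `|i| = 1 by rewrite normc_def /= expr0n /= add0r expr1n sqrtr1.
  by move=> j; rewrite /d; case: ifP => _; [|case: ifP => _]; rewrite ?normrN ?normr1.
- by rewrite -val_eqE /= neq_ltn m0.
- by rewrite /d /= m0.
- by rewrite /d /= ltnn -{1}[m]addn0 ltn_add2l m0.
move=> s s0; have sg0 : 0 <= s *: g by exact: vl_scale_ge0.
pose z : complexification E := (f, s *: g).
have zE : cmod z = f + s *: g by apply: cmod_disjoint => //; exact: vdisjointZr.
have powersE (t : seq E) (j : 'I_n) :
    nth 0 (nseq m z ++ nseq m (cconj z) ++ [seq cembed x | x <- t]) j =
    if (j < m)%N then z else if (j < m + m)%N then cconj z else
      nth 0 [seq cembed x | x <- t] (j - (m + m)).
  rewrite nth_cat size_nseq; case: ltnP => jm; first by rewrite nth_nseq jm.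
  rewrite nth_cat size_nseq ltn_subLR//; case: ltnP => jmm.
    by rewrite nth_nseq ltn_subLR// jmm.
  by rewrite subnDA.
rewrite -zE; have [oddn|evenn] := boolP (odd n).
  have n12 : n.-1./2 = m by rewrite /m nm oddn; lia.
  rewrite odd_case//; congr (cextend T); apply/funext => j.
  rewrite n12 /powers /= (powersE [:: cmod z]) /d.
  case: ifP => jm; first by rewrite /= mulr0 mulr1 scale0r addr0.
  case: ifP => jmm; first by rewrite /= oppr0 mulr0 mulrN1 scale0r addr0 scaleNr.
  have -> : (j - (m + m) = 0)%N by have := ltn_ord j; lia.
  by rewrite /= mulr1 mulr0 scale0r zE.
rewrite even_case//; congr (cextend T); apply/funext => j.
rewrite /powers /= (powersE [::]) /d -/m.
case: ifP => jm; first by rewrite /= mulr0 mulr1 scale0r addr0.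
case: ifP => jmm; first by rewrite /= oppr0 mulr0 mulrN1 scale0r addr0 scaleNr.
by have := ltn_ord j; lia.
Qed.

Lemma orthosymmetric_mixed (f g : E) k : orthosymmetric T ->
  (1 <= k <= n.-1)%N -> vdisjoint f g ->
  T (powers [:: (f, (n - k)%N); (g, k)]) = 0.
Proof.
move=> Torth /andP[k0 kn] fg; have n0 : (0 < n)%N := ltnW n_gt1.
have nk : (n - k < n)%N by rewrite ltn_subrL k0.
apply: Torth; exists (Ordinal n0), (Ordinal nk).
rewrite /powers /= !nth_cat !size_nseq ltnn subnn !nth_nseq.
by rewrite subn_gt0 k0 (leq_ltn_trans kn) ?ltn_predL.
Qed.

End converses.

Lemma powers_ind (V : nmodType) n (s : seq (V * nat)) (Q : V -> Prop) :
  Q 0 -> (forall p, p \in s -> Q p.1) -> forall j : 'I_n, Q (powers s j).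
Proof.
move=> Q0 Qs j; rewrite /powers; set t := flatten _.
have [jt|tj] := ltnP j (size t); last by rewrite nth_default.
have /flattenP[r /mapP[p ps ->]] := mem_nth 0 jt.
by move=> /nseqP[-> _]; exact: Qs.
Qed.

Section modulus.
Context {R : realType} {E : vlatticeType R} {Y : convexBornType R} {n : nat}.
Hypothesis (archE : archimedean E) (compE : uniformly_complete E).
Variables (P : E -> Y) (T : ('I_n -> E) -> Y).
Hypotheses (PT : homogeneous_polynomial P T) (Pb : bounded_map P).
Hypothesis (Torth : orthosymmetric T) (n_gt0 : (0 < n)%N).

(** Both parities at once: [s] is empty if [n] is even, and consists of a single
    exponent one if [n] is odd. At a point of the spectrum [z] times its conjugate
    becomes the square of the modulus. *)
Lemma orthosymmetric_modulus (m : nat) (s : seq nat) (z : complexification E) :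
  (m + m + sumn s)%N = n ->
  cembed (P (cmod z)) =
  cextend T (powers ([:: (z, m); (cconj z, m)] ++ [seq (cembed (cmod z), k) | k <- s])).
Proof.
case: z => f g mn; set z : complexification E := (f, g).
have [um mE] := cmod_ev archE compE f g.
set u := vabs f + vabs g in um mE; rewrite -/z in um mE.
have u0 : 0 <= u by rewrite vaddr_ge0 ?vabs_ge0.
have uf : uideal u f by exists 1; rewrite scale1r vler_addr ?vabs_ge0.
have ug : uideal u g by exists 1; rewrite scale1r /u addrC vler_addr ?vabs_ge0.
have uw0 : uideal u (0 : E) by exact: uideal0.
apply/esym/(cextend_factor archE compE PT Pb Torth n_gt0 u0) => //.
- apply: (powers_ind (Q := fun w : complexification E => uideal u w.1)) => // w.
  by rewrite mem_cat !inE -orbA => /or3P[/eqP->|/eqP->|/mapP[k _ ->]].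
- apply: (powers_ind (Q := fun w : complexification E => uideal u w.2)) => // w.
  rewrite mem_cat !inE -orbA => /or3P[/eqP->|/eqP->|/mapP[k _ ->]] //=.
  exact: uidealN.
move=> phi phiP.
rewrite (prod_powers (fun w : complexification E => Complex (phi w.1) (phi w.2))); last first.
  by rewrite big_cat big_map !big_cons big_nil /= addn0 -sumnE.
rewrite big_cat big_map !big_cons big_nil /= mulr1 (evN phiP)// (ev0 phiP).
set c := phi (cmod z).
have norm2 : Complex (phi f) (phi g) * Complex (phi f) (- phi g) = real_complex R (c ^+ 2).
  rewrite mE//; apply/eqP; rewrite eq_complex /=.
  by apply/andP; split; apply/eqP; ring.
rewrite -exprMn norm2 -expr_sum -[Complex c 0]/(real_complex R c) -!rmorphXn -rmorphM /=.
by rewrite -exprM -exprD mul2n -addnn -sumnE mn.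
Qed.

End modulus.

Theorem theorem2p3 (R : realType) (E : vlatticeType R) (Y : convexBornType R)
    (n r : nat) (P : E -> Y) (T : ('I_n -> E) -> Y) :
  archimedean E -> uniformly_complete E ->
  (1 < n)%N -> (1 < r)%N ->
  homogeneous_polynomial P T -> bounded_map P ->
  [<-> (* (i) *) orthogonally_additive P;
   (* (ii) *) positively_orthogonally_additive P;
   (* (iii) *) orthosymmetric T;
   (* (iv) *) forall k : nat, (1 <= k <= n.-1)%N ->
     forall f g : E, vdisjoint f g -> T (powers [:: (f, (n - k)%N); (g, k)]) = 0;
   (* (v) *) forall f : 'I_r -> E, (forall k, 0 <= f k) ->
     P (fcalc (@Smean R n r) f) = \sum_(k < r) P (f k);
   (* (vi) *) forall f : 'I_n -> E, (forall k, 0 <= f k) ->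
     P (fcalc (@Gmean R n) f) = T f;
   (* (vii) *)
     (~~ odd n -> forall z : complexification E,
        cembed (P (cmod z)) =
        cextend T (powers [:: (z, n./2); (cconj z, n./2)])) /\
     (odd n -> forall z : complexification E,
        cembed (P (cmod z)) =
        cextend T (powers [:: (z, n.-1./2); (cconj z, n.-1./2);
                              (cembed (cmod z), 1%N)]))].
Proof.
move=> archE compE n1 r1 PT Pb.
have n0 : (0 < n)%N := ltnW n1.
have addT := additive_orthosymmetric archE compE PT Pb.
have mixed_additive : (forall k : nat, (1 <= k <= n.-1)%N ->
     forall f g : E, vdisjoint f g -> T (powers [:: (f, (n - k)%N); (g, k)]) = 0) ->
    orthogonally_additive P.
  by move=> mixed f g fg; apply: (additive_at PT n0) => k kn; exact: mixed.
have orth_mixed : orthosymmetric T -> forall k : nat, (1 <= k <= n.-1)%N ->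
     forall f g : E, vdisjoint f g -> T (powers [:: (f, (n - k)%N); (g, k)]) = 0.
  by move=> Torth k kn f g fg; exact: orthosymmetric_mixed.
tfae.
- by move=> add f g _ _; exact: add.
- exact: addT.
- exact: orth_mixed.
- move=> /mixed_additive add f f0.
  apply: (orthosymmetric_Smean archE compE PT Pb) => //.
  by apply: addT => g h _ _; exact: add.
- move=> /(Smean_additive archE PT n1 r1)/addT Torth f f0.
  exact: (orthosymmetric_Gmean archE compE PT Pb).
- move=> /(Gmean_orthosymmetric archE PT n1) Torth; split => oddn z.
    apply: (orthosymmetric_modulus archE compE PT Pb Torth n0 (s := [::])).
    by rewrite /= addn0 addnn even_halfK.
  apply: (orthosymmetric_modulus archE compE PT Pb Torth n0 (s := [:: 1%N])).
  by case: (n) n0 oddn => //= m _ om; rewrite addn0 addn1 addnn even_halfK.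
- by move=> [even_case odd_case];
    apply/mixed_additive/orth_mixed/addT/(modulus_additive archE PT n1).
Qed.
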